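(* For every $n\in\mathbb{N}$, the set $\mathcal{C}_n=\big\{f\in\bigcap_{p<1}H^p : \beta(f^{(n)})\notin \ell^\infty\big\}$ is a $G_\delta$ and dense subset of $\bigcap_{p<1}H^p$.
   Context: $\mathbb{D}$ is the open unit disc in $\mathbb{C}$. For $0<p<1$, $H^p$ is the set of holomorphic $f:\mathbb{D}\to\mathbb{C}$ with $\sup_{0<r<1}\frac{1}{2\pi}\int_0^{2\pi}|f(re^{i\theta})|^p\,d\theta<+\infty$, with metric $d_p(f,g)=\sup_{0<r<1}\frac{1}{2\pi}\int_0^{2\pi}|f(re^{i\theta})-g(re^{i\theta})|^p\,d\theta$. The space $\bigcap_{p<1}H^p$ (intersection over $0<p<1$) carries the metric $d(f,g)=\sum_{n=1}^\infty 2^{-n}\frac{d_{p_n}(f,g)}{1+d_{p_n}(f,g)}$, where $(p_n)$ is any strictly increasing sequence in $(0,1)$ converging to $1$; equivalently, convergence in this space is convergence in $H^p$ for every $0<p<1$. For a holomorphic function $g$ on $\mathbb{D}$, $\beta(g)=(\beta_k(g))_{k=0}^\infty$ is the sequence of its Taylor coefficients at $0$, i.e. $g(z)=\sum_{k\ge 0}\beta_k(g)z^k$; $f^{(n)}$ denotes the $n$-th complex derivative of $f$. $\ell^\infty$ is the set of bounded complex sequences. *)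

(* Defs.v *)
(* The complex plane is [R[i]^o], i.e. the complex numbers
   over an arbitrary [R : realType] as a normed space over themselves, so that
   [derivable f z 1] and [derive1n] are complex differentiability and complex
   derivatives. *)
From HB Require Import structures.
From mathcomp Require Import all_boot all_order all_algebra.
From mathcomp Require Import complex.
From mathcomp Require Import all_classical all_reals all_analysis.
From mathcomp Require Import measurable_realfun borel_hierarchy.

Set Implicit Arguments.
Unset Strict Implicit.
Unset Printing Implicit Defensive.

Import Order.TTheory GRing.Theory Num.Theory numFieldNormedType.Exports.

Local Open Scope ring_scope.
Local Open Scope classical_set_scope.

Notation cplx R := (R[i]%type^o).

Section Definitions.
Context {R : realType}.
Implicit Types (f g h : cplx R -> cplx R) (p r t : R) (z : cplx R).

(* The real-valued modulus; [`|z|] itself has values in [R[i]]. *)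
Definition cmod z : R := Normc.normc z.

Definition unit_disc : set (cplx R) := [set z | cmod z < 1].

Definition holomorphic f := forall z, unit_disc z -> derivable f z 1.

(* r e^{it} *)
Definition circle_pt r t : cplx R := Complex (r * cos t) (r * sin t).

Definition circle_mean p r f : \bar R :=
  (((2 * pi)^-1)%:E *
   \int[lebesgue_measure]_(t in `[0%R, (2 * pi)%R])
     (cmod (f (circle_pt r t)) `^ p)%:E)%E.

Definition hardy_sup p f : \bar R :=
  ereal_sup [set circle_mean p r f | r in `]0, 1[ ].

Definition hardy p : set (cplx R -> cplx R) :=
  [set f | holomorphic f /\ (hardy_sup p f < +oo)%E].

Definition hardy_dist p f g : R := fine (hardy_sup p (fun z => f z - g z)).

Definition taylor_coef f (k : nat) : cplx R := derive1n k f 0 / (k`!)%:R.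

Definition linfty : set (nat -> cplx R) :=
  [set a | exists M : R, forall k, cmod (a k) <= M].

End Definitions.

(* The exponents p_1 < p_2 < ... are indexed from 0. *)
Record exponents (R : realType) := Exponents {
  expo :> nat -> R;
  expo_itv : forall k, 0 < expo k < 1;
  expo_incr : forall j k, (j < k)%N -> expo j < expo k;
  expo_cvg : expo @ \oo --> (1 : R)
}.

(* Functions on the disc are represented by their extension by 0 to the plane,
   so that equality in this type is equality on the disc.  The exponents [e]
   only serve to select the metric. *)
Record hardy_cap (R : realType) (e : exponents R) := HardyCap {
  hfun :> cplx R -> cplx R;
  hfun_hardy : forall p : R, 0 < p < 1 -> hardy p hfun;
  hfun_out : forall z, ~ unit_disc z -> hfun z = 0
}.

Definition hardy_cap_term (R : realType) (e : exponents R)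
    (f g : hardy_cap e) (k : nat) : R :=
  2^-1 ^+ k.+1 * (hardy_dist (e k) f g / (1 + hardy_dist (e k) f g)).

Definition hardy_cap_dist (R : realType) (e : exponents R)
    (f g : hardy_cap e) : R :=
  limn (series (hardy_cap_term f g)).

Section DistanceFacts.
Context {R : realType}.
Implicit Types (f g h : cplx R -> cplx R) (p r t : R) (z : cplx R).

Lemma cmodE z : `|z| = (cmod z)%:C%C. Proof. by []. Qed.

Lemma cmod_ge0 z : 0 <= cmod z.
Proof. by case: z => a b; exact: sqrtr_ge0. Qed.

Lemma cmodD z1 z2 : cmod (z1 + z2) <= cmod z1 + cmod z2.
Proof. exact: le_normcD. Qed.

Lemma cmodN z : cmod (- z) = cmod z. Proof. exact: normcN. Qed.

Lemma cmod0 : cmod 0 = 0 :> R. Proof. exact: Normc.normc0. Qed.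

Lemma cmod_eq0 z : cmod z = 0 -> z = 0.
Proof. exact: Normc.eq0_normc. Qed.

Lemma cmod_le (a b : R) : cmod (Complex a b) <= `|a| + `|b|.
Proof.
rewrite -(@ler_pXn2r _ 2) ?nnegrE ?addr_ge0 ?cmod_ge0//.
rewrite /cmod /= sqr_sqrtr ?addr_ge0 ?sqr_ge0// sqrrD !real_normK ?num_real//.
by rewrite lerD2r lerDl mulrn_wge0 ?mulr_ge0.
Qed.

Lemma cmod_circle r t : 0 <= r -> cmod (circle_pt r t) = r.
Proof.
move=> r0; rewrite /cmod /circle_pt /= !exprMn -mulrDr cos2Dsin2 mulr1.
by rewrite sqrtr_sqr ger0_norm.
Qed.

Lemma continuous_cmod (T : topologicalType) (u : T -> cplx R) (x : T) :
  {for x, continuous u} -> {for x, continuous (fun y => cmod (u y))}.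
Proof.
move=> cu; apply/cvgrPdist_lt => e e0.
have /cvgrPdist_lt/(_ e%:C%C) := cu; rewrite ltcR => /(_ e0).
apply: filterS => y; rewrite cmodE ltcR; apply: le_lt_trans.
have d (a b : cplx R) : cmod a - cmod b <= cmod (a - b).
  by rewrite lerBlDr; rewrite -[in leLHS](subrK b a); exact: cmodD.
by rewrite ler_norml d andbT lerNl opprB -(cmodN (u x - u y)) opprB d.
Qed.

Lemma continuous_circle r : continuous (circle_pt r : R -> cplx R).
Proof.
move=> t; apply/cvgrPdist_lt => -[e e'].
rewrite ltcE /= => /andP[/eqP -> e0].
have cc : {for t, continuous (fun t => r * cos t)}.
  by apply: cvgM; [exact: cvg_cst|exact: continuous_cos].
have cs : {for t, continuous (fun t => r * sin t)}.
  by apply: cvgM; [exact: cvg_cst|exact: continuous_sin].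
have e2 : 0 < e / 2 by rewrite divr_gt0.
move/cvgrPdist_lt: cc => /(_ _ e2) cc; move/cvgrPdist_lt: cs => /(_ _ e2) cs.
near=> s; rewrite cmodE -[ltRHS]/(e%:C)%C ltcR (le_lt_trans (cmod_le _ _))//.
by rewrite [ltRHS]splitr ltrD//; near: s.
Unshelve. all: by end_near. Qed.

Lemma holomorphic_continuous f z : holomorphic f -> unit_disc z ->
  {for z, continuous f}.
Proof.
move=> hf /hf dz; apply: differentiable_continuous.
exact/derivable1_diffP.
Qed.

Lemma holomorphicD f g : holomorphic f -> holomorphic g ->
  holomorphic (fun z => f z + g z).
Proof. by move=> hf hg z Dz; apply: derivableD; [exact: hf|exact: hg]. Qed.

Lemma holomorphicN f : holomorphic f -> holomorphic (fun z => - f z).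
Proof. by move=> hf z Dz; apply: derivableN; exact: hf. Qed.

Lemma holomorphicB f g : holomorphic f -> holomorphic g ->
  holomorphic (fun z => f z - g z).
Proof. by move=> hf hg; exact: (holomorphicD hf (holomorphicN hg)). Qed.

Lemma continuous_cmod_circle f r : holomorphic f -> 0 <= r < 1 ->
  continuous (fun t : R => cmod (f (circle_pt r t))).
Proof.
move=> hf /andP[r0 r1] t; apply: continuous_cmod.
apply: (@continuous_comp _ _ _ (circle_pt r) f).
  exact: continuous_circle.
apply: holomorphic_continuous => //.
rewrite -[unit_disc _]/(is_true (cmod _ < 1)).
by rewrite cmod_circle.
Qed.

Lemma measurable_cmod_circle f p r (D : set R) : holomorphic f -> 0 <= r < 1 ->
  measurable_fun D (fun t => (cmod (f (circle_pt r t)) `^ p)%:E ).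
Proof.
move=> hf hr; apply: measurable_funTS; apply/measurable_EFinP.
apply: (measurableT_comp (measurable_powR p)) => /=.
apply: continuous_measurable_fun.
exact: continuous_cmod_circle.
Qed.

Lemma powR_subadd (a b p : R) : 0 < p <= 1 -> 0 <= a -> 0 <= b ->
  (a + b) `^ p <= a `^ p + b `^ p.
Proof.
move=> /andP[p0 p1] a0 b0.
have [/eqP|ab0] := eqVneq (a + b) 0.
  rewrite paddr_eq0// => /andP[/eqP-> /eqP->].
  by rewrite addr0 powR0 ?gt_eqF// addr0.
have s0 : 0 < a + b by rewrite lt_def ab0 addr_ge0.
have key c : 0 <= c -> c <= a + b -> c / (a + b) * (a + b) `^ p <= c `^ p.
  rewrite le_eqVlt => /predU1P[<- _|c0 cab]; first by rewrite !mul0r powR_ge0.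
  have -> : c `^ p = (c / (a + b)) `^ p * (a + b) `^ p.
    by rewrite -powRM ?divr_ge0 ?ltW// divfK.
  rewrite ler_wpM2r ?powR_ge0// ger1_powR//.
  by rewrite divr_gt0//= ler_pdivrMr// mul1r.
rewrite -[leLHS]mul1r -{1}(divff ab0) [in leLHS]mulrDl mulrDl.
by rewrite lerD// key// ?lerDl ?lerDr.
Qed.

Lemma circle_mean_ge0 p r f : (0 <= circle_mean p r f)%E.
Proof.
apply: mule_ge0; first by rewrite lee_fin invr_ge0 mulr_ge0 ?pi_ge0.
by apply: integral_ge0 => t _; rewrite lee_fin powR_ge0.
Qed.

Lemma circle_meanD p r f g : 0 < p <= 1 -> 0 <= r < 1 ->
  holomorphic f -> holomorphic g ->
  (circle_mean p r (fun z => f z + g z)%R <=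
   circle_mean p r f + circle_mean p r g)%E.
Proof.
move=> hp hr hf hg; have := hp => /andP[p0 _].
rewrite /circle_mean -ge0_muleDr; last 2 first.
- by apply: integral_ge0 => t _; rewrite lee_fin powR_ge0.
- by apply: integral_ge0 => t _; rewrite lee_fin powR_ge0.
apply: lee_wpmul2l; first by rewrite lee_fin invr_ge0 mulr_ge0 ?pi_ge0.
have pow0 h t : (0 <= (cmod (h (circle_pt r t)) `^ p)%:E)%E.
  by rewrite lee_fin powR_ge0.
rewrite -ge0_integralD//; last 2 first.
- exact: measurable_cmod_circle.
- exact: measurable_cmod_circle.
apply: ge0_le_integral => //.
- by move=> t _; exact: (pow0 (fun z => f z + g z)).
- exact: (measurable_cmod_circle _ (holomorphicD hf hg) hr).
- by apply: emeasurable_funD;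
    exact: measurable_cmod_circle.
- move=> t _; rewrite -EFinD lee_fin.
  apply: le_trans (powR_subadd hp (cmod_ge0 _) (cmod_ge0 _)).
  by apply: ge0_ler_powR; rewrite ?nnegrE ?addr_ge0 ?cmod_ge0 ?cmodD// ltW.
Qed.

Lemma hardy_sup_ub p r f : 0 < r < 1 -> (circle_mean p r f <= hardy_sup p f)%E.
Proof. by move=> hr; apply: ereal_sup_ubound; exists r; rewrite //= in_itv. Qed.

Lemma hardy_sup_ge0 p f : (0 <= hardy_sup p f)%E.
Proof.
apply: le_trans (circle_mean_ge0 p 2^-1 f) _; apply: hardy_sup_ub.
by rewrite invr_gt0 invf_lt1 ?ltr1n ?ltr0n.
Qed.

Lemma hardy_supD p f g : 0 < p <= 1 -> holomorphic f -> holomorphic g ->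
  (hardy_sup p (fun z => f z + g z)%R <= hardy_sup p f + hardy_sup p g)%E.
Proof.
move=> hp hf hg; apply: ge_ereal_sup => _ [r /= + <-]; rewrite in_itv /= => hr.
have /andP[r0 r1] := hr.
apply: le_trans (circle_meanD hp _ hf hg) _; first by rewrite ltW.
by apply: leeD; exact: hardy_sup_ub.
Qed.

Lemma hardy_supN p f : hardy_sup p (fun z => - f z) = hardy_sup p f.
Proof.
rewrite /hardy_sup /circle_mean; congr ereal_sup; apply: eq_imagel => r _.
by congr (_ * _)%E; apply: eq_integral => t _; rewrite cmodN.
Qed.

Lemma hardy_sup_fin p f g : 0 < p <= 1 -> hardy p f -> hardy p g ->
  hardy_sup p (fun z => f z - g z) \is a fin_num.
Proof.
move=> hp [hf fp] [hg gp]; rewrite ge0_fin_numE; last exact: hardy_sup_ge0.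
apply: (le_lt_trans (hardy_supD hp hf (holomorphicN hg))).
move: gp; rewrite -(hardy_supN p g) => gp.
exact: (lte_add_pinfty fp gp).
Qed.

Lemma hardy_dist_ge0 p f g : 0 <= hardy_dist p f g.
Proof. by apply: fine_ge0; exact: hardy_sup_ge0. Qed.

Lemma hardy_dist_sym p f g : hardy_dist p f g = hardy_dist p g f.
Proof.
rewrite /hardy_dist -(hardy_supN p (fun z => f z - g z)).
have -> : (fun z => - (f z - g z)) = (fun z => g z - f z) => //.
by apply/funext => z; rewrite opprB.
Qed.

Lemma hardy_distxx p f : 0 < p -> hardy_dist p f f = 0.
Proof.
move=> p0; rewrite /hardy_dist.
suff -> : hardy_sup p (fun z => f z - f z) = 0%E by [].
apply/eqP; rewrite eq_le hardy_sup_ge0 andbT.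
apply: ge_ereal_sup => _ [r _ <-].
rewrite /circle_mean integral0_eq ?mule0// => t _.
by rewrite subrr cmod0 powR0 // gt_eqF.
Qed.

Lemma hardy_dist_triangle p f g h : 0 < p <= 1 ->
  hardy p f -> hardy p g -> hardy p h ->
  hardy_dist p f h <= hardy_dist p f g + hardy_dist p g h.
Proof.
move=> hp Hf Hg Hh; rewrite /hardy_dist.
have Ffg := hardy_sup_fin hp Hf Hg; have Fgh := hardy_sup_fin hp Hg Hh.
have Ffh := hardy_sup_fin hp Hf Hh.
rewrite -(fineD Ffg Fgh).
apply: fine_le.
  exact: Ffh.
  by rewrite fin_numD; apply/andP; split; [exact: Ffg|exact: Fgh].
have -> : (fun z => f z - h z) = (fun z => (f z - g z) + (g z - h z)).
  by apply/funext => z; rewrite addrA subrK.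
case: Hf Hg Hh => [hf _] [hg _] [hh _].
exact: (hardy_supD hp (holomorphicB hf hg) (holomorphicB hg hh)).
Qed.

Lemma continuous_integral_eq0 p (u : R -> R) (a b : R) : 0 < p -> a < b ->
  continuous u -> (forall t, 0 <= u t) ->
  (\int[lebesgue_measure]_(t in `[a, b]) (u t `^ p)%:E = 0)%E ->
  forall t, a <= t <= b -> u t = 0.
Proof.
move=> p0 ab cu u0 int0 t0 t0ab; apply/eqP; apply/negPn/negP => ut0.
have up : 0 < u t0 by rewrite lt_def ut0 u0.
have /cvgrPdist_lt/(_ (u t0 / 2)) := cu t0.
rewrite divr_gt0// => /(_ isT) [d /= d0 dP].
pose c := Num.max a (t0 - d / 2); pose e := Num.min b (t0 + d / 2).
have /andP[at0 t0b] := t0ab.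
have d2 : 0 < d / 2 by rewrite divr_gt0.
have ce : c < e.
  have l1 : t0 - d / 2 < t0 by rewrite ltrBlDr ltrDl.
  have l2 : t0 < t0 + d / 2 by rewrite ltrDl.
  rewrite /c /e lt_min !gt_max ab /= (lt_le_trans l1 t0b)/=.
  by rewrite (le_lt_trans at0 l2)/= (lt_trans l1 l2).
have mu : measurable_fun setT (fun t => (u t `^ p)%:E).
  apply/measurable_EFinP; apply: (measurableT_comp (measurable_powR p)) => /=.
  exact: continuous_measurable_fun.
suff : (0 < \int[lebesgue_measure]_(t in `[a, b]) (u t `^ p)%:E)%E.
  by rewrite int0 ltxx.
apply: (@lt_le_trans _ _
  (\int[lebesgue_measure]_(t in `[c, e]) (u t `^ p)%:E)%E); last first.
  apply: ge0_subset_integral => //.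
  - exact: measurable_funTS.
  - by move=> t _; rewrite lee_fin powR_ge0.
  - move=> t /=; rewrite !in_itv /= /c /e ge_max le_min.
    by move=> /andP[/andP[-> _] /andP[-> _]].
apply: (@lt_le_trans _ _
  (\int[lebesgue_measure]_(t in `[c, e]) (cst ((u t0 / 2) `^ p)%:E t))%E).
  rewrite integral_cst; last by [].
  rewrite /= lebesgue_measure_itv.
  rewrite /= lte_fin ce -EFinD -EFinM.
  by rewrite lte_fin mulr_gt0 ?powR_gt0 ?divr_gt0 ?subr_gt0.
apply: ge0_le_integral => //.
- by move=> t _; rewrite lee_fin powR_ge0.
- exact: measurable_funTS.
- move=> t /=; rewrite in_itv /= /c /e ge_max le_min lee_fin.
  move=> /andP[/andP[_ tl] /andP[_ tr]].
  apply: ge0_ler_powR; rewrite ?nnegrE ?u0 ?divr_ge0// ?(ltW p0)//.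
  have /dP : ball_ Num.norm t0 d t.
    rewrite /ball_ /= (@le_lt_trans _ _ (d / 2))//; last first.
      by rewrite ltr_pdivrMr// ltr_pMr// ltr1n.
    by rewrite ler_distlC tl tr.
  rewrite ltr_distlC => /andP[+ _] => /ltW.
  by rewrite {1}[u t0]splitr addrK.
Qed.

Lemma circle_ptP z : exists2 t, 0 <= t <= 2 * pi & z = circle_pt (cmod z) t.
Proof.
have [/cmod_eq0 ->|z0] := eqVneq (cmod z) 0.
  exists 0; first by rewrite lexx mulr_ge0 ?pi_ge0.
  by rewrite cmod0 /circle_pt !mul0r.
case: z z0 => a b; set r := cmod _ => r0.
have rp : 0 < r by rewrite lt_def r0 cmod_ge0.
have r2 : r ^+ 2 = a ^+ 2 + b ^+ 2.
  by rewrite /r /cmod /= sqr_sqrtr ?addr_ge0 ?sqr_ge0.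
have ar : -1 <= a / r <= 1.
  rewrite -ler_norml normf_div (ger0_norm (ltW rp)) ler_pdivrMr// mul1r.
  rewrite -(@ler_pXn2r _ 2) ?nnegrE ?(ltW rp)// r2 real_normK ?num_real//.
  by rewrite lerDl sqr_ge0.
have ca : r * cos (acos (a / r)) = a.
  by rewrite acosK ?in_itv//= mulrC divfK.
have sa : r * sin (acos (a / r)) = `|b|.
  rewrite sin_acos// -{1}(ger0_norm (ltW rp)) -sqrtr_sqr -sqrtrM ?sqr_ge0//.
  rewrite mulrBr mulr1 -exprMn [r * _]mulrC divfK// r2 addrAC subrr add0r.
  by rewrite sqrtr_sqr.
have a0 := acos_ge0 ar; have api := acos_lepi ar.
have [b0|b0] := leP 0 b.
  exists (acos (a / r)).
    by rewrite a0 (le_trans api)// mulr2n mulrDl mul1r lerDl pi_ge0.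
  by rewrite /circle_pt ca sa ger0_norm.
exists (2 * pi - acos (a / r)).
  rewrite subr_ge0 gerBl a0 andbT (le_trans api)//.
  by rewrite mulr2n mulrDl mul1r lerDl pi_ge0.
have -> : 2 * pi = pi *+ 2 :> R by rewrite mulr_natl.
by rewrite /circle_pt cosB sinB cos2pi sin2pi !mul0r !mul1r addr0 sub0r mulrN
  ca sa ltr0_norm// opprK.
Qed.

Lemma hardy_sup_eq0 p f : 0 < p -> holomorphic f -> hardy_sup p f = 0%E ->
  forall z, unit_disc z -> f z = 0.
Proof.
move=> p0 hf f0.
have nz z : 0 < cmod z -> unit_disc z -> f z = 0.
  move=> z0 z1; have [t t2pi ->] := circle_ptP z.
  apply: cmod_eq0; set r := cmod z in z0 z1 *.
  have r1 : r < 1 := z1.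
  have rr : 0 <= r < 1 by rewrite (ltW z0) r1.
  have pi2 : 0 < 2 * pi :> R by rewrite mulr_gt0 ?pi_gt0.
  have H := continuous_integral_eq0 p0 pi2 (continuous_cmod_circle hf rr)
    (fun t => cmod_ge0 _).
  apply: H t2pi.
  have : circle_mean p r f = 0%E.
    apply/eqP; rewrite eq_le circle_mean_ge0 andbT -f0.
    by apply: hardy_sup_ub; rewrite z0 r1.
  move=> /eqP; rewrite /circle_mean mule_eq0 => /orP[|/eqP//].
  by rewrite eqe invr_eq0 mulf_eq0 pnatr_eq0/= gt_eqF ?pi_gt0.
move=> z z1; have [z0|] := ltP 0 (cmod z); first exact: nz.
move=> zle; have {zle}-> : z = 0.
  by apply: cmod_eq0; apply/eqP; rewrite eq_le zle cmod_ge0.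
apply: cmod_eq0; apply/eqP; rewrite eq_le cmod_ge0 andbT.
apply/ler_addgt0Pl => e e0; rewrite addr0.
have c0 : cmod (0 : cplx R) = 0 by exact: cmod0.
have D0 : unit_disc (0 : cplx R) by rewrite /unit_disc /mkset c0 ltr01.
have h01 : 0 <= (0 : R) < 1 by rewrite lexx ltr01.
pose u (s : R) := cmod (f (circle_pt s 0)).
have cu : {for 0, continuous u}.
  apply: continuous_cmod.
  apply: (@continuous_comp _ _ _ (circle_pt ^~ 0) f); last first.
    rewrite /circle_pt !mul0r; exact: holomorphic_continuous.
  apply/cvgrPdist_lt => -[d d']; rewrite ltcE /= => /andP[/eqP -> d0].
  exists d => //= s sd; rewrite cmodE -[ltRHS]/(d%:C)%C ltcR.
  apply: (le_lt_trans (cmod_le _ _)).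
  by rewrite cos0 sin0 !mulr0 !mulr1 subr0 normr0 addr0.
have u00 : u 0 = cmod (f 0) by rewrite /u /circle_pt !mul0r.
have /cvgrPdist_lt/(_ e e0) [d /= d0 dP] := cu.
pose s := Num.min (d / 2) 2^-1.
have s0 : 0 < s by rewrite lt_min invr_gt0 ltr0n divr_gt0.
have us : u s = 0.
  rewrite /u nz ?cmod0// ?cmod_circle// ?ltW//.
  rewrite -[unit_disc _]/(is_true (cmod _ < 1)) cmod_circle ?ltW//.
  by rewrite gt_min invf_lt1 ?ltr1n ?ltr0n ?orbT.
have /dP : ball_ Num.norm 0 d s.
  rewrite /ball_ /= sub0r normrN gtr0_norm// gt_min.
  by rewrite ltr_pdivrMr// ltr_pMr// ltr1n.
by rewrite /= us subr0 u00 ger0_norm ?cmod_ge0// => /ltW.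
Qed.

End DistanceFacts.

Section MetricFacts.
Context {R : realType} {e : exponents R}.
Implicit Types f g h : hardy_cap e.

Let phi (x : R) := x / (1 + x).

Let phi_ge0 x : 0 <= x -> 0 <= phi x.
Proof. by move=> x0; rewrite divr_ge0 ?addr_ge0. Qed.

Let phi_le1 x : 0 <= x -> phi x <= 1.
Proof. by move=> x0; rewrite ler_pdivrMr ?ltr_wpDr// mul1r lerDr. Qed.

Let phi_subadd x y z : 0 <= x -> 0 <= y -> 0 <= z -> x <= y + z ->
  phi x <= phi y + phi z.
Proof.
move=> x0 y0 z0 xyz.
have px : 0 < 1 + x by rewrite ltr_wpDr.
have py : 0 < 1 + y by rewrite ltr_wpDr.
have pz : 0 < 1 + z by rewrite ltr_wpDr.
have ps : 0 < 1 + (y + z) by rewrite ltr_wpDr// addr_ge0.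
have -> w : phi w = w / (1 + w) by [].
apply: (@le_trans _ _ ((y + z) / (1 + (y + z)))).
  rewrite ler_pdivrMr// mulrAC ler_pdivlMr//.
  by rewrite mulrDr [leRHS]mulrDr !mulr1 [_ * x]mulrC lerD2r.
rewrite mulrDl; apply: lerD; apply: ler_wpM2l => //;
  rewrite lef_pV2 ?posrE// lerD2l ?lerDl ?lerDr//.
Qed.

Let e0 k : 0 < e k. Proof. by have /andP[] := expo_itv e k. Qed.
Let e01 k : 0 < e k <= 1.
Proof. by have /andP[-> /ltW] := expo_itv e k. Qed.

Lemma hardy_cap_term_ge0 f g k : 0 <= hardy_cap_term f g k.
Proof.
apply: mulr_ge0; first by rewrite exprn_ge0.
by apply: phi_ge0; exact: hardy_dist_ge0.
Qed.

Lemma hardy_cap_term_cvg f g : cvgn (series (hardy_cap_term f g)).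
Proof.
apply: (@series_le_cvg _ _ (geometric 2^-1 2^-1)).
- by move=> k; exact: hardy_cap_term_ge0.
- by move=> k; rewrite /geometric /= mulr_ge0 ?exprn_ge0.
- move=> k; rewrite /geometric /= -exprS /hardy_cap_term.
  rewrite ler_piMr ?exprn_ge0//; apply: phi_le1; exact: hardy_dist_ge0.
- by apply: is_cvg_geometric_series; rewrite ger0_norm ?invf_lt1 ?ltr1n.
Qed.

Lemma hardy_cap_distxx f : hardy_cap_dist f f = 0.
Proof.
rewrite /hardy_cap_dist.
have -> : hardy_cap_term f f = fun=> 0.
  by apply/funext => k; rewrite /hardy_cap_term hardy_distxx// mul0r mulr0.
apply/cvg_lim => //; under eq_cvg do rewrite /series /= big1//.
exact: cvg_cst.
Qed.

Lemma hardy_cap_dist_sym f g : hardy_cap_dist f g = hardy_cap_dist g f.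
Proof.
have E : hardy_cap_term f g = hardy_cap_term g f.
  apply/funext => k; rewrite /hardy_cap_term.
  by have -> : hardy_dist (e k) f g = hardy_dist (e k) g f
    by exact: hardy_dist_sym.
by rewrite /hardy_cap_dist E.
Qed.

Lemma hardy_cap_dist_triangle g f h :
  hardy_cap_dist f h <= hardy_cap_dist f g + hardy_cap_dist g h.
Proof.
rewrite /hardy_cap_dist -lim_seriesD; [|exact: hardy_cap_term_cvg..].
apply: lim_series_le.
- exact: hardy_cap_term_cvg.
- by apply: is_cvg_seriesD; exact: hardy_cap_term_cvg.
move=> k; rewrite /hardy_cap_term /= -mulrDr; apply: ler_wpM2l.
  by rewrite exprn_ge0.
apply: phi_subadd; [exact: hardy_dist_ge0..|].
by apply: hardy_dist_triangle => //; exact: (hfun_hardy _ (expo_itv e k)).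
Qed.

Lemma hardy_cap_dist_eq0 f g : hardy_cap_dist f g = 0 -> f = g.
Proof.
move=> fg0.
have t0 : hardy_cap_term f g 0 <= 0.
  rewrite -fg0; apply: le_trans (nondecreasing_cvgn_le _ _ 1).
  - by rewrite /series /= big_nat1.
  - apply: nondecreasing_series => k _ _; exact: hardy_cap_term_ge0.
  - exact: hardy_cap_term_cvg.
have d0 : hardy_dist (e 0) f g = 0.
  apply/eqP; rewrite eq_le hardy_dist_ge0 andbT leNgt; apply/negP => dp.
  move: t0; rewrite leNgt => /negP; apply.
  by rewrite mulr_gt0 ?exprn_gt0// divr_gt0// ltr_wpDl.
have Hf := hfun_hardy f (expo_itv e 0); have Hg := hfun_hardy g (expo_itv e 0).
have s0 : hardy_sup (e 0) (fun z => f z - g z) = 0%E.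
  by rewrite -(fineK (hardy_sup_fin (e01 0) Hf Hg)); congr EFin.
have fg z : f z = g z.
  have [Dz|Dz] := pselect (unit_disc z); last by rewrite !hfun_out.
  apply/eqP; rewrite -subr_eq0; apply/eqP.
  case: Hf Hg => [hf _] [hg _].
  exact: (hardy_sup_eq0 (e0 0) (holomorphicB hf hg) s0 Dz).
case: f g fg {fg0 t0 d0 Hf Hg s0} => [f Hf of0] [g Hg og] /= /funext fg.
by subst g; congr HardyCap; exact: Prop_irrelevance.
Qed.

End MetricFacts.

HB.instance Definition _ (R : realType) (e : exponents R) :=
  gen_eqMixin (hardy_cap e).
HB.instance Definition _ (R : realType) (e : exponents R) :=
  gen_choiceMixin (hardy_cap e).
HB.instance Definition _ (R : realType) (e : exponents R) :=
  isMetric.Build R (hardy_cap e) (@hardy_cap_distxx R e)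
    (@hardy_cap_dist_eq0 R e) (@hardy_cap_dist_sym R e)
    (@hardy_cap_dist_triangle R e).

Definition unbounded_taylor (R : realType) (e : exponents R) (n : nat) :
    set (hardy_cap e) :=
  [set f | ~ linfty (taylor_coef (derive1n n f))].

Arguments unbounded_taylor {R} e n.

(* Main.v *)
Require Import Defs.
From mathcomp Require Import all_boot all_order all_algebra.
From mathcomp Require Import all_classical all_reals all_analysis.
From mathcomp Require Import borel_hierarchy.
From mathcomp Require Import complex ring lra.

(** The set is a countable intersection of open sets because each Taylor
    coefficient at 0 of each derivative is a continuous function on the
    intersection of the Hardy spaces, and it is dense because this space
    contains one function [g], explicit, whose coefficients are unbounded: if
    the coefficients of the derivative of order [n] of [f] are bounded, those of
    [f + a g] are not, and [f + a g] tends to [f] with [a].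

    Continuity of the coefficients asks for two things. First, one value of
    the metric must control [f] uniformly on a small disc
    ([hardy_pointwise], [hardy_small_uniform]). For exponents [p < 1] there is no
    triangle inequality for the norms and no Cauchy formula for [|f|^p]; instead
    one writes [|f| = |f|^(1 - p) |f|^p] on a circle, bounds the first factor by a
    weighted supremum of [|f|] and absorbs it. Secondly, a uniform bound on a
    disc must control all derivatives at 0 ([derive1n_bound]), by Cauchy
    estimates.

    Both rest on Cauchy's theory for functions that are merely complex
    differentiable, which is developed from the start. Bisection of polar
    rectangles ([polar_goursat]) shows that the mean of a holomorphic function
    over a circle does not depend on the radius, and letting the radius tend to
    zero in the mean of a difference quotient represents [f'] as a circle mean
    ([cauchy_derivative]). This formula yields in turn that [f'] is bounded,
    Lipschitz and finally differentiable ([holomorphic_derive1]). Since [f'] is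
    differentiable, the difference quotient [(f z - f w) / (z - w)] is holomorphic
    at [w] too, and the mean value property applied to it is Cauchy's formula
    ([cauchy_formula]).

    The function [g] is [- log (1 - z) / (1 - z)], with coefficients the harmonic
    numbers ([derive1n_witness]). The logarithm is [O (|1 - z|^-a)] for every
    [a > 0], so that [|g|^p] is dominated by [|1 - z|^-s] for some [s < 1], whose
    integrals over the circles are bounded ([hardy_witness]). *)

Set Implicit Arguments.
Unset Strict Implicit.
Unset Printing Implicit Defensive.

Import Order.TTheory GRing.Theory Num.Theory numFieldNormedType.Exports.

Local Open Scope ring_scope.
Local Open Scope classical_set_scope.

Local Notation Re := complex.Re.
Local Notation Im := complex.Im.

(** * The real-valued modulus *)
Section Modulus.
Context {R : realType}.
Implicit Types (z w h : cplx R) (x : R).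

Lemma cmodM z w : cmod (z * w) = cmod z * cmod w.
Proof. exact: Normc.normcM. Qed.

Lemma cmodV z : cmod z^-1 = (cmod z)^-1.
Proof. exact: Normc.normcV. Qed.

Lemma cmod1 : cmod (1 : cplx R) = 1.
Proof. exact: Normc.normc1. Qed.

Lemma cmodX z n : cmod (z ^+ n) = cmod z ^+ n.
Proof. by elim: n => [|n IH]; rewrite ?expr0 ?cmod1// !exprS cmodM IH. Qed.

Lemma cmodB z w : cmod (z - w) <= cmod z + cmod w.
Proof. by rewrite -(cmodN w); exact: cmodD. Qed.

Lemma cmod_distC z w : cmod (z - w) = cmod (w - z).
Proof. by rewrite -cmodN opprB. Qed.

Lemma ler_cmodB z w : cmod z - cmod w <= cmod (z - w).
Proof. by rewrite lerBlDr -{1}(subrK w z) cmodD. Qed.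

Lemma cmod_gt0 z : (0 < cmod z) = (z != 0).
Proof.
rewrite lt_def cmod_ge0 andbT; congr (~~ _); apply/eqP/eqP => [|->].
  exact: cmod_eq0.
exact: cmod0.
Qed.

Lemma cmod_real x : cmod (x%:C)%C = `|x|.
Proof. by rewrite /cmod /= expr0n addr0 sqrtr_sqr. Qed.

Lemma cmod_nat n : cmod (n%:R : cplx R) = n%:R.
Proof.
have -> : (n%:R : cplx R) = (n%:R : R)%:C%C by rewrite rmorph_nat.
by rewrite cmod_real ger0_norm.
Qed.

Lemma cmod_conj z : cmod (z^*)%C = cmod z.
Proof. by case: z => a b; rewrite /cmod /= sqrrN. Qed.

Lemma normr_Re z : `|Re z| <= cmod z.
Proof.
case: z => a b; rewrite /cmod /= -sqrtr_sqr.
by apply: ler_wsqrtr; rewrite lerDl sqr_ge0.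
Qed.

Lemma normr_Im z : `|Im z| <= cmod z.
Proof.
case: z => a b; rewrite /cmod /= -sqrtr_sqr.
by apply: ler_wsqrtr; rewrite lerDr sqr_ge0.
Qed.

Lemma mulJ_cmod z : (z^*)%C * z = ((cmod z) ^+ 2)%:C%C.
Proof.
case: z => a b; rewrite /cmod /= sqr_sqrtr ?addr_ge0 ?sqr_ge0//.
by apply/eqP; rewrite eq_complex /=; apply/andP; split; apply/eqP; ring.
Qed.

End Modulus.

(** * Complex derivatives *)
Section ComplexDerivative.
Context {R : realType}.
Implicit Types (f g : cplx R -> cplx R) (z w h l : cplx R).

Lemma nbhs_cmodP z (P : set (cplx R)) :
  nbhs z P <-> exists2 d : R, 0 < d & forall w, cmod (w - z) < d -> P w.
Proof.
rewrite -nbhs_ballE; split=> [[[d d'] + dP]|[d d0 dP]].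
  rewrite /= ltcE /= => /andP[/eqP d'0 d0]; exists d => // w wz.
  apply: dP; rewrite -ball_normE /ball_ /= -normrN opprB cmodE d'0.
  by rewrite -[ltRHS]/(d%:C)%C ltcR.
exists (d%:C)%C; first by rewrite /= ltcR.
move=> w; rewrite -ball_normE /ball_ /= -normrN opprB cmodE ltcR.
exact: dP.
Qed.

Lemma continuous_cmodP f z :
  (forall e : R, 0 < e -> exists2 d : R, 0 < d &
    forall w, cmod (w - z) < d -> cmod (f w - f z) <= e) ->
  {for z, continuous f}.
Proof.
move=> H A /nbhs_cmodP[e e0 eA]; have [d d0 dP] := H (e / 2) (divr_gt0 e0 (ltr0Sn _ _)).
apply/nbhs_cmodP; exists d => // w /dP we; apply: eA; apply: (le_lt_trans we).
by rewrite ltr_pdivrMr// ltr_pMr// ltr1n.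
Qed.

(** Complex differentiability with a real [e] and [d]: the norm of [cplx R] takes
    its values in the complex numbers, whereas every estimate below is real. *)
Definition cderiv f z l := forall e : R, 0 < e ->
  exists2 d : R, 0 < d &
    forall h, cmod h < d -> cmod (f (z + h) - f z - l * h) <= e * cmod h.

Lemma is_derive_cderiv f z l : is_derive z 1 f l -> cderiv f z l.
Proof.
move=> [dfz <-] e e0; move: dfz; rewrite /derivable /derive.
set F := (fun h => h^-1 *: _) => cF.
have /cvgrPdist_le/(_ e%:C%C) : F @ 0^' --> lim (F @ 0^') by [].
rewrite ltcR => /(_ e0).
rewrite /dnbhs /within /= => /nbhs_cmodP[d d0 dP]; exists d => // h hd.
have [->|h0] := eqVneq h 0; first by rewrite addr0 mulr0 subr0 subrr cmod0 mulr0.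
have := dP h; rewrite subr0 => /(_ hd h0).
rewrite distrC cmodE lecR => H.
have -> : f (z + h) - f z - lim (F @ 0^') * h = (F h - lim (F @ 0^')) * h.
  have -> : F h = h^-1 * (f (z + h) - f z).
    by rewrite /F /= [h *: _]mulr1 (addrC h).
  by rewrite mulrBl mulrAC mulVf// mul1r.
by rewrite cmodM ler_wpM2r ?cmod_ge0.
Qed.

Lemma cderiv_is_derive f z l : cderiv f z l -> is_derive z 1 f l.
Proof.
move=> dfz.
have H : (fun h => h^-1 *: ((f \o shift z) (h *: (1 : cplx R)) - f z)) @ 0^' --> l.
  apply/cvgrPdist_le => -[e e']; rewrite ltcE /= => /andP[/eqP -> e0].
  have [d d0 dP] := dfz _ e0.
  rewrite /dnbhs /within /=; apply/nbhs_cmodP; exists d => // h.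
  rewrite subr0 => /dP H h0; rewrite distrC cmodE -[leRHS]/(e%:C)%C lecR.
  rewrite -(@ler_pM2r _ (cmod h)) ?cmod_gt0// -cmodM.
  apply: le_trans H; rewrite le_eqVlt; apply/orP; left; apply/eqP.
  congr cmod; rewrite /= [h *: 1]mulr1 (addrC h) mulrBl.
  by rewrite [_ *: _ * h]mulrAC mulVf// mul1r.
apply: DeriveDef; first by apply/cvg_ex; exists l.
exact: cvg_lim H.
Qed.

Lemma derivable_cderiv f z : derivable f z 1 -> cderiv f z (derive1 f z).
Proof. by move=> df; apply: is_derive_cderiv; rewrite derive1E; exact: derivableP. Qed.

Lemma cderiv_derive1 f z l : cderiv f z l -> derive1 f z = l.
Proof. by move=> /cderiv_is_derive[_ <-]; rewrite derive1E. Qed.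

Lemma cderiv_derivable f z l : cderiv f z l -> derivable f z 1.
Proof. by move=> /cderiv_is_derive[]. Qed.

Lemma cderiv_continuous f z l : cderiv f z l -> {for z, continuous f}.
Proof.
move=> /cderiv_derivable df.
by apply: differentiable_continuous; exact/derivable1_diffP.
Qed.

Lemma cderivD f g z k l : cderiv f z k -> cderiv g z l ->
  cderiv (fun w => f w + g w) z (k + l).
Proof.
by move=> /cderiv_is_derive df /cderiv_is_derive dg; apply: is_derive_cderiv; exact: is_deriveD.
Qed.

Lemma cderivN f z k : cderiv f z k -> cderiv (fun w => - f w) z (- k).
Proof.
by move=> /cderiv_is_derive df; apply: is_derive_cderiv; exact: is_deriveN.
Qed.

Lemma cderivB f g z k l : cderiv f z k -> cderiv g z l ->
  cderiv (fun w => f w - g w) z (k - l).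
Proof. by move=> df /cderivN; exact: cderivD. Qed.

Lemma cderiv_eq f z k l : cderiv f z k -> k = l -> cderiv f z l.
Proof. by move=> ? <-. Qed.

Lemma cderivM f g z k l : cderiv f z k -> cderiv g z l ->
  cderiv (fun w => f w * g w) z (f z * l + g z * k).
Proof.
by move=> /cderiv_is_derive df /cderiv_is_derive dg; apply: is_derive_cderiv; exact: is_deriveM.
Qed.

Lemma cderivV f z k : cderiv f z k -> f z != 0 ->
  cderiv (fun w => (f w)^-1) z (- k / f z ^+ 2).
Proof.
move=> /cderiv_is_derive [df <-] fz0; apply: is_derive_cderiv.
apply: DeriveDef; first exact: derivableV.
by rewrite deriveV// mulNr mulrC -mulNr.
Qed.

Lemma cderiv_cst c z : cderiv (fun=> c) z 0.
Proof. by apply: is_derive_cderiv; exact: is_derive_cst. Qed.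

Lemma cderiv_id z : cderiv (fun w => w) z 1.
Proof. by apply: is_derive_cderiv; exact: is_derive_id. Qed.

Lemma cderivZ f z k c : cderiv f z k -> cderiv (fun w => c * f w) z (c * k).
Proof.
move=> df; apply: cderiv_eq (cderivM (cderiv_cst c z) df) _.
by rewrite mulr0 addr0.
Qed.

Lemma cderiv_shift f z w k : cderiv f (w + z) k -> cderiv (fun u => f (w + u)) z k.
Proof. by move=> df e /df[d d0 dP]; exists d => // h /dP; rewrite addrA. Qed.

Lemma near_cderiv f g z k (d : R) : 0 < d ->
  (forall w, cmod (w - z) < d -> f w = g w) -> cderiv f z k -> cderiv g z k.
Proof.
move=> d0 fg df e /df[d1 d10 d1P]; exists (Num.min d d1); first by rewrite lt_min d0.
move=> h; rewrite lt_min => /andP[hd /d1P].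
by rewrite !fg ?subrr ?cmod0// addrC addKr.
Qed.

End ComplexDerivative.

(** * The mean value inequality *)
Section MeanValueInequality.
Context {R : realType}.
Implicit Types (f : cplx R -> cplx R) (z w h l c : cplx R).

Lemma real_is_derive (phi : R -> R) (s l : R) :
  (forall e : R, 0 < e -> exists2 d : R, 0 < d & forall x : R, `|x| < d ->
     `|phi (s + x) - phi s - l * x| <= e * `|x|) ->
  is_derive s 1 phi l.
Proof.
move=> dphi.
have H : (fun h : R => h^-1 *: ((phi \o shift s) (h *: 1) - phi s)) @ 0^' --> l.
  apply/cvgrPdist_le => e e0; have [d d0 dP] := dphi _ e0.
  rewrite /dnbhs /within /=; exists d => // h.
  rewrite /ball_ /= sub0r normrN => /dP H h0.
  rewrite distrC -(@ler_pM2r _ `|h|) ?normr_gt0// -normrM.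
  apply: le_trans H; rewrite le_eqVlt; apply/orP; left; apply/eqP.
  congr `|_|; rewrite /= [h *: 1]mulr1 (addrC h) mulrBl.
  by rewrite [_ *: _ * h]mulrAC mulVf// mul1r.
apply: DeriveDef; first by apply/cvg_ex; exists l.
exact: cvg_lim H.
Qed.

Lemma is_derive_Re_line f z h c l (s : R) : cderiv f (z + s%:C%C * h) l ->
  is_derive s 1 (fun t : R => Re (c * f (z + t%:C%C * h))) (Re (c * (l * h))).
Proof.
move=> df; apply: real_is_derive => e e0.
pose K := cmod c * cmod h + 1.
have K0 : 0 < K by rewrite ltr_wpDl// mulr_ge0 ?cmod_ge0.
have [d d0 dP] := df _ (divr_gt0 e0 K0).
have h1 : 0 < cmod h + 1 by rewrite ltr_wpDl ?cmod_ge0.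
exists (d / (cmod h + 1)); first exact: divr_gt0.
move=> t; rewrite ltr_pdivlMr// => td.
have E : z + (s + t)%:C%C * h = z + s%:C%C * h + t%:C%C * h.
  by rewrite rmorphD /= mulrDl addrA.
have alg (A B k m v : cplx R) : Re (k * A) - Re (k * B) - Re (k * (m * v)) * t
    = Re (k * (A - B - m * (t%:C%C * v))).
  by move: A B k m v => [? ?] [? ?] [? ?] [? ?] [? ?] /=; ring.
rewrite E alg.
apply: (le_trans (normr_Re _)); rewrite cmodM.
have /dP : cmod (t%:C%C * h) < d.
  rewrite cmodM cmod_real (le_lt_trans _ td)// ler_wpM2l//.
  by rewrite lerDl.
move=> /(ler_wpM2l (cmod_ge0 c)) /le_trans; apply.
rewrite cmodM cmod_real.
have -> : cmod c * (e / K * (`|t| * cmod h)) = e * `|t| * (cmod c * cmod h / K).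
  by clearbody K; field; rewrite gt_eqF.
rewrite ler_piMr// ?mulr_ge0 ?(ltW e0)//.
by rewrite ler_pdivrMr// mul1r lerDl.
Qed.

(** With [D] the increment of [f], the real function
    [s |-> Re (D^* * f (z + s * h))] grows by [cmod D ^+ 2] on [0, 1], and the real
    mean value theorem bounds that growth by [cmod D * (M * cmod h)]. *)
Lemma mean_value_inequality f (df : cplx R -> cplx R) z h (M : R) :
  (forall s : R, 0 <= s <= 1 ->
    cderiv f (z + s%:C%C * h) (df (z + s%:C%C * h))) ->
  (forall s : R, 0 <= s <= 1 -> cmod (df (z + s%:C%C * h)) <= M) ->
  cmod (f (z + h) - f z) <= M * cmod h.
Proof.
move=> fdf dfM.
pose D := f (z + h) - f z; pose c := (D^*)%C.
pose phi (t : R) := Re (c * f (z + t%:C%C * h)).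
pose dphi (t : R) := Re (c * (df (z + t%:C%C * h) * h)).
have dph (s : R) : 0 <= s <= 1 -> is_derive s 1 phi (dphi s).
  by move=> /fdf; exact: is_derive_Re_line.
have [||s] := @MVT_segment _ phi dphi 0 1 ler01.
- by move=> s; rewrite in_itv /= => /andP[s0 s1]; apply: dph; rewrite !ltW.
- apply: continuous_in_subspaceT => s; rewrite inE /= in_itv /= => /dph[ds _].
  by apply: differentiable_continuous; exact/derivable1_diffP.
rewrite in_itv /= => s01; rewrite subr0 mulr1 => E.
have {}E : cmod D ^+ 2 = dphi s.
  rewrite -E /phi mul1r mul0r addr0.
  rewrite -[LHS]/(Re ((cmod D ^+ 2)%:C%C)) -mulJ_cmod -/c /D.
  have alg (k A B : cplx R) : Re (k * (A - B)) = Re (k * A) - Re (k * B).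
    by move: k A B => [? ?] [? ?] [? ?] /=; ring.
  exact: alg.
have H : cmod D ^+ 2 <= cmod D * (M * cmod h).
  rewrite E; apply: (le_trans (ler_norm _)).
  apply: (le_trans (normr_Re _)); rewrite cmodM cmod_conj.
  by rewrite ler_wpM2l ?cmod_ge0// cmodM ler_wpM2r ?cmod_ge0// dfM.
have [D0|] := ltP 0 (cmod D).
  by rewrite -(ler_pM2l D0) -expr2.
move=> /le_trans; apply; rewrite mulr_ge0 ?cmod_ge0//.
by apply: le_trans (dfM 0 _); rewrite ?cmod_ge0// lexx ler01.
Qed.

End MeanValueInequality.

(** * Integrals of complex functions of a real variable *)
Section ComplexIntegral.
Context {R : realType}.
Notation mu := (@lebesgue_measure R).
Implicit Types (u v : R -> cplx R) (a b c t M : R).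

(** By components, so that these integrals inherit the theory of real integrals. *)
Definition cint a b u : cplx R :=
  Complex (\int[mu]_(t in `[a, b]) Re (u t)) (\int[mu]_(t in `[a, b]) Im (u t)).

Definition seg_cont (T : topologicalType) a b (u : R -> T) :=
  forall t, a <= t <= b -> {for t, continuous u}.

Lemma seg_cont_integrable a b (u : R -> R) : seg_cont a b u ->
  mu.-integrable `[a, b] (EFin \o u).
Proof.
move=> cu; apply: continuous_compact_integrable; first exact: segment_compact.
by apply: continuous_in_subspaceT => t; rewrite inE /= in_itv /=; exact: cu.
Qed.

Lemma seg_cont_Re a b u : seg_cont a b u -> seg_cont a b (fun t => Re (u t)).
Proof.
move=> cu t /cu{}cu; apply/cvgrPdist_lt => e e0.
have /cvgrPdist_lt/(_ e%:C%C) := cu; rewrite ltcR => /(_ e0).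
apply: filterS => y; rewrite cmodE ltcR; apply: le_lt_trans.
by apply: le_trans (normr_Re _); case: (u t) (u y) => ? ? [].
Qed.

Lemma seg_cont_Im a b u : seg_cont a b u -> seg_cont a b (fun t => Im (u t)).
Proof.
move=> cu t /cu{}cu; apply/cvgrPdist_lt => e e0.
have /cvgrPdist_lt/(_ e%:C%C) := cu; rewrite ltcR => /(_ e0).
apply: filterS => y; rewrite cmodE ltcR; apply: le_lt_trans.
by apply: le_trans (normr_Im _); case: (u t) (u y) => ? ? [].
Qed.

Lemma seg_cont_cmod a b u : seg_cont a b u -> seg_cont a b (fun t => cmod (u t)).
Proof. by move=> cu t /cu; exact: continuous_cmod. Qed.

Lemma seg_contM a b u v : seg_cont a b u -> seg_cont a b v ->
  seg_cont a b (fun t => u t * v t).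
Proof. by move=> cu cv t ab; apply: cvgM; [exact: cu|exact: cv]. Qed.

Lemma seg_contB a b u v : seg_cont a b u -> seg_cont a b v ->
  seg_cont a b (fun t => u t - v t).
Proof. by move=> cu cv t ab; apply: cvgB; [exact: cu|exact: cv]. Qed.

Lemma seg_cont_cst (T : topologicalType) a b (k : T) : seg_cont a b (fun=> k).
Proof. by move=> t _; exact: cvg_cst. Qed.

Let integrable_Re a b u (cu : seg_cont a b u) :=
  seg_cont_integrable (seg_cont_Re cu).
Let integrable_Im a b u (cu : seg_cont a b u) :=
  seg_cont_integrable (seg_cont_Im cu).

Lemma eq_cint a b u v : (forall t, a <= t <= b -> u t = v t) ->
  cint a b u = cint a b v.
Proof.
move=> uv; rewrite /cint; congr Complex; apply: eq_Rintegral => t;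
  by rewrite inE /= in_itv /= => /uv ->.
Qed.

Lemma cintD a b u v : seg_cont a b u -> seg_cont a b v ->
  cint a b (fun t => u t + v t) = cint a b u + cint a b v.
Proof.
move=> cu cv; rewrite /cint; apply/eqP; rewrite eq_complex /=.
rewrite -!RintegralD//; do 4?[exact: integrable_Re|exact: integrable_Im].
by apply/andP; split; apply/eqP/eq_Rintegral => t _; case: (u t) (v t) => ? ? [].
Qed.

Lemma cintZ a b u k : seg_cont a b u ->
  cint a b (fun t => k * u t) = k * cint a b u.
Proof.
move=> cu; have iR := integrable_Re cu; have iI := integrable_Im cu.
have iZ (r : R) (w : R -> R) : mu.-integrable `[a, b] (EFin \o w) ->
    mu.-integrable `[a, b] (EFin \o (fun t => r * w t)).
  by move=> iw; exact: (integrableZl _ r iw).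
case: k => p q; rewrite /cint; apply/eqP; rewrite eq_complex /=.
rewrite -!RintegralZl// -RintegralB -?RintegralD//; do ?exact: iZ.
by apply/andP; split; apply/eqP/eq_Rintegral => t _; case: (u t).
Qed.

Lemma cintN a b u : seg_cont a b u ->
  cint a b (fun t => - u t) = - cint a b u.
Proof.
by move=> cu; rewrite -mulN1r -cintZ//; apply: eq_cint => t _; rewrite mulN1r.
Qed.

Lemma cintB a b u v : seg_cont a b u -> seg_cont a b v ->
  cint a b (fun t => u t - v t) = cint a b u - cint a b v.
Proof.
move=> cu cv; have cNv : seg_cont a b (fun t => - v t).
  by move=> t /cv; exact: cvgN.
by rewrite (cintD cu cNv) cintN.
Qed.

Lemma cint_conj a b u : seg_cont a b u ->
  cint a b (fun t => (u t)^*%C) = (cint a b u)^*%C.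
Proof.
move=> cu; rewrite /cint; apply/eqP; rewrite eq_complex /=.
rewrite -mulN1r -RintegralZl//; last exact: integrable_Im.
apply/andP; split; apply/eqP/eq_Rintegral => t _; case: (u t) => // p q.
by rewrite /= mulN1r.
Qed.

Lemma cint_cst a b k : a <= b -> cint a b (fun=> k) = (b - a)%:C%C * k.
Proof.
move=> ab; rewrite /cint !Rintegral_cst//=.
have -> : fine (mu `[a, b]%classic) = b - a.
  rewrite lebesgue_measure_itv /= lte_fin; have [//|ba] := ltP a b.
  by rewrite (@le_anti _ _ a b) ?ab ?ba// subrr.
by case: k => p q; apply/eqP; rewrite eq_complex /=; apply/andP; split; apply/eqP; ring.
Qed.

(** Multiplying by the conjugate of the value of the integral turns the claim
    into an inequality between integrals of real functions. *)
Lemma cmod_cint a b u : seg_cont a b u ->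
  cmod (cint a b u) <= \int[mu]_(t in `[a, b]) cmod (u t).
Proof.
move=> cu; set I := cint a b u; pose J : cplx R := (I^*)%C.
have iu : mu.-integrable `[a, b] (EFin \o (fun t => cmod (u t))).
  exact: (seg_cont_integrable (seg_cont_cmod cu)).
have cI : seg_cont a b (fun t => J * u t).
  exact: (seg_contM (@seg_cont_cst _ a b J) cu).
have E : cmod I ^+ 2 = \int[mu]_(t in `[a, b]) Re (J * u t).
  by rewrite -[LHS]/(Re ((cmod I ^+ 2)%:C%C)) -mulJ_cmod -cintZ.
have H : cmod I ^+ 2 <= cmod I * \int[mu]_(t in `[a, b]) cmod (u t).
  rewrite E -RintegralZl//; apply: le_Rintegral => //.
  - exact: (integrable_Re cI).
  - exact: (integrableZl _ (cmod I) iu).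
  - move=> t _; apply: (le_trans (ler_norm _)).
    by apply: (le_trans (normr_Re _)); rewrite cmodM cmod_conj.
have [I0|] := ltP 0 (cmod I); first by rewrite -(ler_pM2l I0) -expr2.
by move=> /le_trans; apply; apply: Rintegral_ge0 => t _; exact: cmod_ge0.
Qed.

Lemma cmod_cint_le a b u M : a <= b -> seg_cont a b u ->
  (forall t, a <= t <= b -> cmod (u t) <= M) ->
  cmod (cint a b u) <= M * (b - a).
Proof.
move=> ab cu uM; apply: (le_trans (cmod_cint cu)).
have -> : M * (b - a) = \int[mu]_(t in `[a, b]) M.
  rewrite Rintegral_cst//= lebesgue_measure_itv /= lte_fin.
  have [//|ba] := ltP a b; by rewrite (@le_anti _ _ a b) ?ab ?ba// subrr.
apply: le_Rintegral => //.
- exact: (seg_cont_integrable (seg_cont_cmod cu)).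
- exact: (@seg_cont_integrable a b (fun=> M) (@seg_cont_cst R a b M)).
Qed.

Lemma cint_split a c b u : a <= c <= b -> seg_cont a b u ->
  cint a b u = cint a c u + cint c b u.
Proof.
move=> /andP[ac cb] cu.
have H (w : R -> R) : mu.-integrable `[a, b] (EFin \o w) ->
    \int[mu]_(t in `[a, b]) w t =
    \int[mu]_(t in `[a, c]) w t + \int[mu]_(t in `[c, b]) w t.
  move=> iw; apply/eqP; rewrite addrC -subr_eq; apply/eqP.
  rewrite Rintegral_itvB//; do ?by rewrite bnd_simp.
  apply: Rintegral_itv_obnd_cbnd; apply: integrableS iw => //.
  by move=> t /=; rewrite !in_itv /= => /andP[/ltW/(le_trans ac) -> ->].
by rewrite /cint !H//; do ?[exact: integrable_Re|exact: integrable_Im].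
Qed.

Lemma Rint_FTC a b (U u : R -> R) : a <= b ->
  (forall t, a <= t <= b -> is_derive t 1 U (u t)) -> seg_cont a b u ->
  \int[mu]_(t in `[a, b]) u t = U b - U a.
Proof.
rewrite le_eqVlt => /predU1P[<- _ _|ab dU cu].
  by rewrite set_itv1 Rintegral_set1 subrr.
have cU t : a <= t <= b -> {for t, continuous U}.
  move=> /dU[dUt _].
  by apply: differentiable_continuous; exact/derivable1_diffP.
rewrite /Rintegral (@continuous_FTC2 _ u U)//.
- by apply: continuous_in_subspaceT => t; rewrite inE /= in_itv /=; exact: cu.
- split.
  + by move=> t; rewrite in_itv /= => /andP[at_ tb]; have [] := dU t _; rewrite ?ltW.
  + by apply: cvg_at_right_filter; apply: cU; rewrite lexx ltW.
  + by apply: cvg_at_left_filter; apply: cU; rewrite lexx ltW.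
- move=> t; rewrite in_itv /= => /andP[at_ tb].
  by rewrite derive1E; have [_ ->] : is_derive t 1 U (u t) by apply: dU; rewrite !ltW.
Qed.

Lemma cint_FTC a b (U u : R -> cplx R) : a <= b ->
  (forall t, a <= t <= b -> is_derive t 1 (fun s => Re (U s)) (Re (u t))) ->
  (forall t, a <= t <= b -> is_derive t 1 (fun s => Im (U s)) (Im (u t))) ->
  seg_cont a b u ->
  cint a b u = U b - U a.
Proof.
move=> ab dR dI cu; rewrite /cint (Rint_FTC ab dR (seg_cont_Re cu)).
by rewrite (Rint_FTC ab dI (seg_cont_Im cu)); case: (U b) (U a) => ? ? [].
Qed.

End ComplexIntegral.

(** * Goursat's theorem on polar rectangles *)
Section PolarGoursat.
Context {R : realType}.
Implicit Types (f g : cplx R -> cplx R) (z w l : cplx R) (a b c s t u r : R).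

Lemma continuous_realC (phi : R -> R) t : {for t, continuous phi} ->
  {for t, continuous (fun s => (phi s)%:C%C : cplx R)}.
Proof.
move=> cphi; apply/cvgrPdist_lt => -[e e']; rewrite ltcE /= => /andP[/eqP -> e0].
have /cvgrPdist_lt/(_ _ e0) := cphi.
by apply: filterS => y H; rewrite -rmorphB /= cmodE cmod_real ltcR.
Qed.

Lemma circle_ptE r t : circle_pt r t = r%:C%C * circle_pt 1 t.
Proof.
by rewrite /circle_pt; apply/eqP; rewrite eq_complex /=; apply/andP; split; apply/eqP; ring.
Qed.

Lemma circle_pt_2pi r : circle_pt r (2 * pi) = circle_pt r 0.
Proof. by rewrite /circle_pt mulr_natl cos2pi sin2pi cos0 sin0. Qed.

Lemma cmod_circle1 t : cmod (circle_pt 1 t) = 1.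
Proof. by rewrite cmod_circle. Qed.

Lemma continuous_radius (t r : R) :
  {for r, continuous (fun r => circle_pt r t : cplx R)}.
Proof.
have -> : (fun r => circle_pt r t : cplx R) = (fun r => r%:C%C * circle_pt 1 t).
  by apply/funext => x; rewrite circle_ptE.
by apply: cvgM; [exact: continuous_realC|exact: cvg_cst].
Qed.

(** The derivative of [t |-> e^(i t)] is ['i * e^(i t)]. *)
Lemma cint_circle1 s t : s <= t ->
  'i%C * cint s t (circle_pt 1) = circle_pt 1 t - circle_pt 1 s.
Proof.
move=> st; have cc : seg_cont s t (circle_pt 1 : R -> cplx R).
  by move=> x _; exact: continuous_circle.
rewrite -(cintZ _ cc); apply: (@cint_FTC _ s t (circle_pt 1) (fun x => 'i%C * circle_pt 1 x) st).
- move=> x _; rewrite /circle_pt /=.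
  have -> : (fun s => 1 * cos s : R) = cos by apply/funext => ?; rewrite mul1r.
  by apply: is_derive_eq; ring.
- move=> x _; rewrite /circle_pt /=.
  have -> : (fun s => 1 * sin s : R) = sin by apply/funext => ?; rewrite mul1r.
  by apply: is_derive_eq; ring.
- exact: (seg_contM (@seg_cont_cst R _ s t ('i%C : cplx R)) cc).
Qed.

(** A chord is shorter than its arc. *)
Lemma cmod_chord s t : cmod (circle_pt 1 t - circle_pt 1 s : cplx R) <= `|t - s|.
Proof.
wlog st : s t / s <= t => [H|].
  have [/H//|/ltW/H] := leP s t; by rewrite cmod_distC distrC.
rewrite -cint_circle1// cmodM ger0_norm ?subr_ge0//.
have -> : cmod ('i%C : cplx R) = 1 by rewrite /cmod /= expr0n expr1n add0r sqrtr1.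
rewrite mul1r -[leRHS]mul1r; apply: cmod_cint_le => //.
  by move=> x _; exact: continuous_circle.
by move=> x _; rewrite cmod_circle1.
Qed.

Lemma cmod_circle_dist r r' s t : 0 <= r' ->
  cmod (circle_pt r t - circle_pt r' s : cplx R) <= `|r - r'| + r' * `|t - s|.
Proof.
move=> r'0.
have -> : circle_pt r t - circle_pt r' s = (r - r')%:C%C * circle_pt 1 t +
   r'%:C%C * (circle_pt 1 t - circle_pt 1 s).
  by rewrite (circle_ptE r) (circle_ptE r') rmorphB /=; ring.
apply: (le_trans (cmodD _ _)); rewrite !cmodM !cmod_real cmod_circle1 mulr1.
by rewrite (ger0_norm r'0) lerD2l ler_wpM2l// cmod_chord.
Qed.

Definition ray_int f t a b := cint a b (fun r => f (circle_pt r t) * (r^-1)%:C%C).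
Definition arc_int f r s t := cint s t (fun x => f (circle_pt r x)).

(** The integral of [f z dz / z] along the boundary of the polar rectangle with
    radii in [a, b] and angles in [s, t], oriented counterclockwise; in polar
    coordinates [dz / z = dr / r + i dt]. With this form, rather than [f z dz], the
    two arcs of a full annulus give directly the means of [f] over two circles. *)
Definition polar_boundary f a b s t : cplx R :=
  ray_int f s a b - ray_int f t a b + 'i%C * (arc_int f b s t - arc_int f a s t).

Definition annulus_cont a b f := forall z, a <= cmod z <= b -> {for z, continuous f}.

Lemma seg_cont_ray f r0 r1 t a b : 0 < r0 -> annulus_cont r0 r1 f ->
  r0 <= a -> b <= r1 -> seg_cont a b (fun r => f (circle_pt r t) * (r^-1)%:C%C).
Proof.
move=> r00 cf r0a br1 r /andP[ar rb].
have rp : 0 < r by rewrite (lt_le_trans r00)// (le_trans r0a).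
apply: cvgM; last first.
  by apply: continuous_realC; apply: cvgV; rewrite ?gt_eqF//; exact: cvg_id.
apply: (@continuous_comp _ _ _ (circle_pt ^~ t) f); first exact: continuous_radius.
by apply: cf; rewrite (cmod_circle _ (ltW rp)) (le_trans r0a ar) (le_trans rb).
Qed.

Lemma seg_cont_arc f r0 r1 r s t : 0 <= r0 -> annulus_cont r0 r1 f ->
  r0 <= r <= r1 -> seg_cont s t (fun x => f (circle_pt r x)).
Proof.
move=> r00 cf /andP[r0r rr1] x _.
apply: (@continuous_comp _ _ _ (circle_pt r) f); first exact: continuous_circle.
by apply: cf; rewrite cmod_circle ?r0r// (le_trans r00).
Qed.

Lemma polar_boundary_split f r0 r1 a b c s t u : 0 < r0 -> annulus_cont r0 r1 f ->
  r0 <= a -> b <= r1 -> a <= c <= b -> s <= u <= t ->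
  polar_boundary f a b s t =
    polar_boundary f a c s u + polar_boundary f c b s u +
    (polar_boundary f a c u t + polar_boundary f c b u t).
Proof.
move=> r00 cf r0a br1 acb sut.
have /andP[ac cb] := acb; have /andP[su ut] := sut.
have ray x : ray_int f x a b = ray_int f x a c + ray_int f x c b.
  by apply: cint_split => //; apply: seg_cont_ray cf _ _.
have arc x : r0 <= x <= r1 -> arc_int f x s t = arc_int f x s u + arc_int f x u t.
  by move=> xr; apply: cint_split => //; apply: seg_cont_arc cf _; rewrite // ltW.
rewrite /polar_boundary !ray !arc; [ring| |];
  by rewrite ?r0a ?br1 (le_trans r0a (le_trans ac cb)) || rewrite ?r0a ?br1 (le_trans (le_trans ac cb) br1).
Qed.

Lemma polar_boundaryD f g r0 r1 a b s t : 0 < r0 ->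
  annulus_cont r0 r1 f -> annulus_cont r0 r1 g -> r0 <= a -> a <= b -> b <= r1 ->
  polar_boundary (fun z => f z + g z) a b s t =
  polar_boundary f a b s t + polar_boundary g a b s t.
Proof.
move=> r00 cf cg r0a ab br1.
have ray x : ray_int (fun z => f z + g z) x a b = ray_int f x a b + ray_int g x a b.
  rewrite /ray_int -(cintD (seg_cont_ray r00 cf r0a br1) (seg_cont_ray r00 cg r0a br1)).
  by apply: eq_cint => r _; rewrite mulrDl.
have arc x : r0 <= x <= r1 ->
    arc_int (fun z => f z + g z) x s t = arc_int f x s t + arc_int g x s t.
  move=> xr; rewrite /arc_int -cintD//.
    exact: (seg_cont_arc (ltW r00) cf xr).
  exact: (seg_cont_arc (ltW r00) cg xr).
rewrite /polar_boundary !ray !arc; [ring| |].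
  by rewrite r0a (le_trans ab).
by rewrite br1 (le_trans r0a).
Qed.

Lemma continuous_affine k l z : {for z, continuous (fun z => k + l * z)}.
Proof.
exact: cderiv_continuous (cderivD (cderiv_cst k z) (cderivZ l (cderiv_id z))).
Qed.

(** The constant [k] drops out of both differences, and [l * z] leaves
    [l * (b - a)] times [e^(i s) - e^(i t)] on the rays, which the arcs cancel by
    [cint_circle1]. *)
Lemma polar_boundary_affine k l a b s t : 0 < a -> a <= b -> s <= t ->
  polar_boundary (fun z => k + l * z) a b s t = 0.
Proof.
move=> a0 ab st.
have cf : annulus_cont a b (fun z => k + l * z).
  by move=> z _; exact: continuous_affine.
rewrite /polar_boundary /ray_int /arc_int.
rewrite -(cintB (seg_cont_ray a0 cf (lexx a) (lexx b)) (seg_cont_ray a0 cf (lexx a) (lexx b))).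
rewrite -(cintB (seg_cont_arc (ltW a0) cf _) (seg_cont_arc (ltW a0) cf _)) ?lexx ?ab//.
under eq_cint => r /andP[ar _].
  have r0 : r%:C%C != 0 :> R[i].
    by apply/eqP => -[/eqP]; rewrite gt_eqF// (lt_le_trans a0).
  rewrite (circle_ptE r s) (circle_ptE r t) fmorphV /=.
  rewrite (_ : _ - _ = l * (circle_pt 1 s - circle_pt 1 t)); last first.
    by field.
  over.
under [X in 'i%C * X]eq_cint => x _.
  rewrite (circle_ptE a x) (circle_ptE b x).
  rewrite (_ : _ - _ = l * (b - a)%:C%C * circle_pt 1 x); last first.
    by rewrite rmorphB /=; ring.
  over.
rewrite cint_cst// cintZ; last by move=> x _; exact: continuous_circle.
rewrite [X in _ + X]mulrCA (cint_circle1 st); ring.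
Qed.

Lemma polar_boundary_le f r0 r1 a b s t M : 0 < r0 -> annulus_cont r0 r1 f ->
  r0 <= a -> a <= b -> b <= r1 -> s <= t ->
  (forall r x, a <= r <= b -> s <= x <= t -> cmod (f (circle_pt r x)) <= M) ->
  cmod (polar_boundary f a b s t) <= M * (2 / r0 * (b - a) + 2 * (t - s)).
Proof.
move=> r00 cf r0a ab br1 st fM.
have ray x : s <= x <= t -> cmod (ray_int f x a b) <= M / r0 * (b - a).
  move=> xst; apply: cmod_cint_le => //; first exact: seg_cont_ray cf _ _.
  move=> r rab; have r0r : r0 <= r by rewrite (le_trans r0a)//; case/andP: rab.
  have rp := lt_le_trans r00 r0r.
  rewrite cmodM cmod_real ger0_norm ?invr_ge0 ?(ltW rp)//.
  apply: ler_pM; rewrite ?cmod_ge0 ?invr_ge0 ?(ltW rp) ?fM//.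
  by rewrite lef_pV2.
have arc x : a <= x <= b -> cmod (arc_int f x s t) <= M * (t - s).
  move=> xab; apply: cmod_cint_le => //; last by move=> y yst; exact: fM.
  apply: seg_cont_arc cf _; first exact: ltW.
  by case/andP: xab => ax xb; rewrite (le_trans r0a ax) (le_trans xb).
apply: (le_trans (cmodD _ _)); rewrite cmodM.
have -> : cmod ('i%C : cplx R) = 1 by rewrite /cmod /= expr0n expr1n add0r sqrtr1.
have H1 := le_trans (cmodB (ray_int f s a b) (ray_int f t a b))
  (lerD (ray s _) (ray t _)).
have H2 := le_trans (cmodB (arc_int f b s t) (arc_int f a s t))
  (lerD (arc b _) (arc a _)).
rewrite mul1r; apply: (le_trans (lerD (H1 _ _) (H2 _ _))); rewrite ?lexx ?ab ?st//.
by rewrite le_eqVlt; apply/orP; left; apply/eqP; ring.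
Qed.

Lemma div_expn_small (D d : R) : 0 <= D -> 0 < d -> exists n, D / 2 ^+ n < d.
Proof.
move=> D0 d0; have [n _ /(_ n (leqnn n))] : \forall n \near \oo, D / 2 ^+ n < d.
  have : (fun n => D / 2 ^+ n) @ \oo --> (0 : R).
    rewrite -(mulr0 D); apply: cvgM; first exact: cvg_cst.
    under eq_cvg do rewrite -exprVn.
    by apply: cvg_expr; rewrite ger0_norm ?invf_lt1// ltr1n.
  move=> /cvgrPdist_lt/(_ _ d0); apply: filterS => n.
  by rewrite sub0r normrN ger0_norm// divr_ge0 ?exprn_ge0.
by exists n.
Qed.

Lemma nested_segments (u w : nat -> R) : (forall n, 0 <= w n) ->
  (forall n, u n <= u n.+1) -> (forall n, u n.+1 + w n.+1 <= u n + w n) ->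
  exists x, forall n, u n <= x <= u n + w n.
Proof.
move=> w0 ui uwd.
have mono m n : (m <= n)%N -> u m <= u n /\ u n + w n <= u m + w m.
  elim: n => [|n IH]; first by rewrite leqn0 => /eqP ->.
  rewrite leq_eqVlt => /predU1P[->//|/IH[H1 H2]]; split.
    exact: le_trans (ui n).
  exact: le_trans H2.
have ub n m : u m <= u n + w n.
  have [mn|/ltnW nm] := leqP m n.
    by rewrite (le_trans (mono _ _ mn).1)// lerDl.
  by apply: le_trans (mono _ _ nm).2; rewrite lerDl.
exists (sup (range u)) => n; apply/andP; split.
  apply: ub_le_sup; last by exists n.
  by exists (u 0%N + w 0%N) => _ [m _ <-].
by apply: ge_sup; [exists (u 0%N); exists 0%N|move=> _ [m _ <-]].
Qed.

Lemma four_quarters (m a b c d : R) : m <= a + b + (c + d) ->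
  m + m + (m + m) <= 4 * a + 4 * b + (4 * c + 4 * d).
Proof. lra. Qed.

(** Goursat's argument: if the integral were not zero, repeated quartering would
    produce polar rectangles shrinking to a point whose boundary integrals decrease
    no faster than [4 ^- n]; but near that point [f] is affine up to [e] times the
    distance, and affine functions have boundary integral zero. *)
Theorem polar_goursat f r0 r1 s0 t0 : 0 < r0 -> r0 <= r1 -> s0 <= t0 ->
  (forall z, r0 <= cmod z <= r1 -> derivable f z 1) ->
  polar_boundary f r0 r1 s0 t0 = 0.
Proof.
move=> r00 r01 st0 df.
have cf : annulus_cont r0 r1 f.
  by move=> z /df /derivable_cderiv; exact: cderiv_continuous.
pose W n : R := (r1 - r0) / 2 ^+ n; pose H n : R := (t0 - s0) / 2 ^+ n.
have W0 n : 0 <= W n by rewrite divr_ge0 ?subr_ge0 ?exprn_ge0.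
have H0 n : 0 <= H n by rewrite divr_ge0 ?subr_ge0 ?exprn_ge0.
have WS n : W n = W n.+1 + W n.+1.
  by rewrite /W exprS; field; rewrite expf_neq0.
have HS n : H n = H n.+1 + H n.+1.
  by rewrite /H exprS; field; rewrite expf_neq0.
pose B n (x : R * R) := polar_boundary f x.1 (x.1 + W n) x.2 (x.2 + H n).
pose inR n (x : R * R) := [&& r0 <= x.1, x.1 + W n <= r1, s0 <= x.2 & x.2 + H n <= t0].
pose sub n (x y : R * R) := [&& x.1 <= y.1, y.1 + W n.+1 <= x.1 + W n,
  x.2 <= y.2 & y.2 + H n.+1 <= x.2 + H n].
have step n x : exists y, inR n x ->
    sub n x y /\ cmod (B n x) <= 4 * cmod (B n.+1 y).
  have [/and4P[r0x xr1 s0x xt0]|] := boolP (inR n x); last by exists x.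
  have E : B n x = B n.+1 x + B n.+1 (x.1 + W n.+1, x.2) +
      (B n.+1 (x.1, x.2 + H n.+1) + B n.+1 (x.1 + W n.+1, x.2 + H n.+1)).
    rewrite /B /= -(addrA x.1) -(addrA x.2) -HS -WS.
    apply: (polar_boundary_split r00 cf r0x xr1).
      by rewrite lerDl W0 (WS n) addrA lerDl W0.
    by rewrite lerDl H0 (HS n) addrA lerDl H0.
  have K : exists2 y, sub n x y & cmod (B n x) <= 4 * cmod (B n.+1 y).
    apply: contrapT => nK.
    have lt4 y : sub n x y -> 4 * cmod (B n.+1 y) < cmod (B n x).
      by move=> sy; rewrite ltNge; apply/negP => le4; apply: nK; exists y.
    have sub1 : sub n x x by rewrite /sub !lexx (WS n) (HS n) !addrA !lerDl W0 H0.
    have sub2 : sub n x (x.1 + W n.+1, x.2).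
      by rewrite /sub /= -addrA -WS !lexx (HS n) !addrA !lerDl W0 H0.
    have sub3 : sub n x (x.1, x.2 + H n.+1).
      by rewrite /sub /= -addrA -HS !lexx (WS n) !addrA !lerDl W0 H0.
    have sub4 : sub n x (x.1 + W n.+1, x.2 + H n.+1).
      by rewrite /sub /= -!addrA -HS -WS !lexx !lerDl W0 H0.
    have := le_trans (cmodD _ _) (lerD (cmodD _ _) (cmodD _ _)).
    move=> /(_ _ (B n.+1 x) (B n.+1 (x.1 + W n.+1, x.2)) (B n.+1 (x.1, x.2 + H n.+1))
       (B n.+1 (x.1 + W n.+1, x.2 + H n.+1))); rewrite -E.
    have := ltrD (ltrD (lt4 _ sub1) (lt4 _ sub2)) (ltrD (lt4 _ sub3) (lt4 _ sub4)).
    by move=> lt1 le1; have := lt_le_trans lt1 (four_quarters le1); rewrite ltxx.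
  by have [y sy By] := K; exists y.
have [nxt nxtP] := choice (fun nx : nat * (R * R) => step nx.1 nx.2).
pose x := fix x n := if n is n'.+1 then nxt (n', x n') else (r0, s0).
have xP n : inR n (x n) /\ cmod (B 0%N (x 0%N)) <= 4 ^+ n * cmod (B n (x n)).
  elim: n => [|n [xn IH]].
    split; last by rewrite expr0 mul1r.
    by rewrite /inR /= /W /H expr0 !divr1 !(addrC r0) !(addrC s0) !subrK !lexx.
  have [/and4P[s1 s2 s3 s4] Bn] := nxtP (n, x n) xn; split.
    move: xn => /and4P[i1 i2 i3 i4]; apply/and4P; split.
    - exact: le_trans s1.
    - exact: le_trans i2.
    - exact: le_trans s3.
    - exact: le_trans i4.
  apply: (le_trans IH); rewrite exprSr -mulrA ler_wpM2l ?exprn_ge0//.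
have xS n : sub n (x n) (x n.+1) by have [] := nxtP (n, x n) (xP n).1.
have [rs rsP] : exists r, forall n, (x n).1 <= r <= (x n).1 + W n.
  by apply: nested_segments => // n; have /and4P[] := xS n.
have [ts tsP] : exists t, forall n, (x n).2 <= t <= (x n).2 + H n.
  by apply: nested_segments => // n; have /and4P[] := xS n.
have rs01 : r0 <= rs <= r1.
  have := rsP 0%N; rewrite /= /W expr0 divr1 => /andP[-> /=].
  by rewrite addrC subrK.
have rs0 : 0 <= rs by rewrite (le_trans (ltW r00))//; case/andP: rs01.
have r10 : 0 < r1 := lt_le_trans r00 r01.
set zs := circle_pt rs ts : cplx R.
have /df/derivable_cderiv dfz : r0 <= cmod zs <= r1 by rewrite cmod_circle.
set l := derive1 f zs in dfz.
pose D := (r1 - r0) + r1 * (t0 - s0).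
pose K := 2 / r0 * (r1 - r0) + 2 * (t0 - s0).
have D0 : 0 <= D by rewrite addr_ge0 ?mulr_ge0 ?subr_ge0// ltW.
have K0 : 0 <= K by rewrite addr_ge0 ?mulr_ge0 ?invr_ge0 ?subr_ge0// ltW.
have main e : 0 < e -> cmod (B 0%N (x 0%N)) <= e * (D * K).
  move=> e0; have [d d0 dP] := dfz _ e0.
  have [n nD] := div_expn_small D0 d0.
  apply: (le_trans (xP n).2).
  have /and4P[i1 i2 i3 i4] := (xP n).1.
  pose k := f zs - l * zs.
  pose rho z := f z - (k + l * z).
  have caff : annulus_cont r0 r1 (fun z => k + l * z).
    by move=> z _; exact: continuous_affine.
  have crho : annulus_cont r0 r1 rho.
    by move=> z zr; exact: cvgB (cf z zr) (caff z zr).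
  have xW : (x n).1 <= (x n).1 + W n by rewrite lerDl.
  have xH : (x n).2 <= (x n).2 + H n by rewrite lerDl.
  have -> : B n (x n) = polar_boundary rho (x n).1 ((x n).1 + W n) (x n).2 ((x n).2 + H n).
    have x0 : 0 < (x n).1 := lt_le_trans r00 i1.
    have := @polar_boundaryD rho _ r0 r1 _ _ (x n).2 ((x n).2 + H n) r00 crho caff i1 xW i2.
    rewrite (polar_boundary_affine k l x0 xW xH) addr0 => <-.
    have Ef : (fun z => rho z + (k + l * z)) = f by apply/funext => z; rewrite /rho subrK.
    by rewrite Ef.
  have := @polar_boundary_le rho r0 r1 _ _ (x n).2 ((x n).2 + H n) (e * (D / 2 ^+ n)) r00 crho i1 xW i2 xH.
  have P2 : 0 < 2 ^+ n :> R by rewrite exprn_gt0.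
  have -> : 2 / r0 * ((x n).1 + W n - (x n).1) + 2 * ((x n).2 + H n - (x n).2) = K / 2 ^+ n.
    by rewrite /K /W /H; field; rewrite !gt_eqF.
  have -> : e * (D * K) = 4 ^+ n * (e * (D / 2 ^+ n) * (K / 2 ^+ n)).
    rewrite (_ : 4 = 2 * 2 :> R); last by rewrite -natrM.
    by rewrite exprMn; field; rewrite gt_eqF.
  rewrite ler_pM2l ?exprn_gt0//; apply.
  move=> r y rr yy.
  have zd : cmod (circle_pt r y - zs : cplx R) <= D / 2 ^+ n.
    apply: (le_trans (cmod_circle_dist _ _ _ rs0)).
    have -> : D / 2 ^+ n = W n + r1 * H n by rewrite /D /W /H; field; rewrite gt_eqF.
    apply: lerD.
      have := rsP n; move: rr => /andP[? ?] /andP[? ?].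
      by rewrite ler_norml; apply/andP; split; lra.
    apply: ler_pM => //; first by case/andP: rs01.
    have := tsP n; move: yy => /andP[? ?] /andP[? ?].
    by rewrite ler_norml; apply/andP; split; lra.
  have := dP _ (le_lt_trans zd nD).
  have -> : f (zs + (circle_pt r y - zs)) - f zs - l * (circle_pt r y - zs) =
     rho (circle_pt r y) by rewrite /rho /k (addrC zs) subrK; ring.
  move=> /le_trans; apply; rewrite ler_pM2l//.
have : cmod (B 0%N (x 0%N)) <= 0.
  apply/ler_addgt0Pl => e e0; rewrite addr0.
  have DK : 0 < D * K + 1 by rewrite ltr_wpDl ?mulr_ge0.
  apply: (le_trans (main _ (divr_gt0 e0 DK))).
  rewrite mulrAC ler_pdivrMr// ler_pM2l//; lra.
rewrite /B /= /W /H expr0 !divr1 !(addrC r0) !(addrC s0) !subrK => H00.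
by apply: cmod_eq0; apply: le_anti; rewrite H00 cmod_ge0.
Qed.

End PolarGoursat.

(** * Circle means of holomorphic functions *)
Section CircleIntegrals.
Context {R : realType}.
Implicit Types (f g : cplx R -> cplx R) (z w h k l : cplx R) (r s M : R).

Definition circle_int f r : cplx R := arc_int f r 0 (2 * pi).

Lemma pi2_gt0 : 0 < 2 * pi :> R.
Proof. by rewrite mulr_gt0 ?pi_gt0. Qed.

Lemma realC_neq0 (x : R) : x != 0 -> x%:C%C != 0 :> cplx R.
Proof. by move=> x0; rewrite -cmod_gt0 cmod_real normr_gt0. Qed.

Lemma seg_cont_circle f r : 0 <= r -> (forall z, cmod z = r -> {for z, continuous f}) ->
  seg_cont 0 (2 * pi) (fun t => f (circle_pt r t)).
Proof.
move=> r0 cf; apply: (@seg_cont_arc _ f r r) => //; last by rewrite lexx.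
by move=> z /le_anti rz; apply: cf.
Qed.

(** In [polar_goursat] for a full annulus the two rays coincide and cancel. *)
Lemma circle_int_const f r0 r1 : 0 < r0 -> r0 <= r1 ->
  (forall z, r0 <= cmod z <= r1 -> derivable f z 1) ->
  circle_int f r0 = circle_int f r1.
Proof.
move=> r00 r01 df; have := polar_goursat r00 r01 (ltW pi2_gt0) df.
rewrite /polar_boundary (_ : ray_int f 0 r0 r1 = ray_int f (2 * pi) r0 r1); last first.
  by apply: eq_cint => r _; rewrite circle_pt_2pi.
rewrite subrr add0r => /eqP; rewrite mulf_eq0 => /orP[/eqP[/eqP]|].
  by rewrite oner_eq0.
by rewrite subr_eq0 => /eqP/esym.
Qed.

Lemma cmod_circle_int f r M : 0 <= r -> (forall z, cmod z = r -> {for z, continuous f}) ->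
  (forall z, cmod z = r -> cmod (f z) <= M) -> cmod (circle_int f r) <= M * (2 * pi).
Proof.
move=> r0 cf fM; rewrite -[X in _ * X]subr0; apply: cmod_cint_le.
- exact: ltW pi2_gt0.
- exact: seg_cont_circle.
- by move=> t _; apply: fM; rewrite cmod_circle.
Qed.

Lemma circle_intB f g r : 0 <= r -> (forall z, cmod z = r -> {for z, continuous f}) ->
  (forall z, cmod z = r -> {for z, continuous g}) ->
  circle_int (fun z => f z - g z) r = circle_int f r - circle_int g r.
Proof. by move=> r0 cf cg; rewrite /circle_int /arc_int cintB//; exact: seg_cont_circle. Qed.

Lemma circle_int_cst k r : circle_int (fun=> k) r = (2 * pi)%:C%C * k.
Proof. by rewrite /circle_int /arc_int cint_cst ?subr0// ltW// pi2_gt0. Qed.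

(** The integral does not depend on the radius, so the radius may tend to zero. *)
Lemma circle_int_puncture f k r : 0 < r ->
  (forall z, 0 < cmod z <= r -> derivable f z 1) ->
  (forall e : R, 0 < e -> exists2 d : R, 0 < d &
    forall z, 0 < cmod z < d -> cmod (f z - k) <= e) ->
  circle_int f r = (2 * pi)%:C%C * k.
Proof.
move=> r0 df fk; apply/eqP; rewrite -subr_eq0; apply/eqP/cmod_eq0/le_anti.
rewrite cmod_ge0 andbT; apply/ler_addgt0Pl => e e0; rewrite addr0.
have [d d0 dP] := fk _ (divr_gt0 e0 pi2_gt0).
pose x := Num.min (d / 2) r.
have x0 : 0 < x by rewrite lt_min r0 divr_gt0.
have xr : x <= r by rewrite ge_min lexx orbT.
have xd : x < d by rewrite gt_min ltr_pdivrMr// ltr_pMr// ltr1n.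
rewrite -(@circle_int_const f x r x0 xr); last first.
  by move=> z /andP[xz zr]; apply: df; rewrite (lt_le_trans x0 xz).
have cf z : cmod z = x -> {for z, continuous f}.
  move=> zx; have dz : derivable f z 1 by apply: df; rewrite zx x0 xr.
  exact: cderiv_continuous (derivable_cderiv dz).
have cc z : cmod z = x -> {for z, continuous (fun=> k : cplx R)}.
  by move=> _; exact: cst_continuous.
rewrite -(circle_int_cst k x) -(circle_intB (ltW x0) cf cc).
have -> : e = e / (2 * pi) * (2 * pi) by rewrite divfK// gt_eqF// pi2_gt0.
apply: cmod_circle_int; first exact: ltW.
  by move=> z zx; exact: cvgB (cf z zx) (cc z zx).
by move=> z zx; apply: dP; rewrite zx x0.
Qed.

Lemma mean_value f r : 0 < r -> (forall z, cmod z <= r -> derivable f z 1) ->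
  circle_int f r = (2 * pi)%:C%C * f 0.
Proof.
move=> r0 df; apply: circle_int_puncture => //.
  by move=> z /andP[_]; exact: df.
move=> e e0.
have /cderiv_continuous/cvgrPdist_le : cderiv f 0 (derive1 f 0).
  by apply: derivable_cderiv; apply: df; rewrite cmod0 ltW.
move=> /(_ e%:C%C); rewrite ltcR => /(_ e0)/nbhs_cmodP[d d0 dP].
exists d => // z /andP[_ zd]; rewrite cmod_distC -lecR -cmodE; apply: dP.
by rewrite subr0.
Qed.

Lemma cderiv_quotient f w : forall z l, z != 0 -> cderiv f (w + z) l ->
  derivable (fun u => (f (w + u) - f w) / u) z 1.
Proof.
move=> z l z0 df; apply: cderiv_derivable.
apply: cderivM; last exact: cderivV (cderiv_id z) z0.
exact: cderivB (cderiv_shift df) (cderiv_cst _ _).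
Qed.

(** The difference quotient of [f] at [w] extends continuously by [derive1 f w],
    which is therefore its mean over the circle. Only this value of the derivative
    appears, so that nothing has to be known yet on the regularity of [derive1 f]. *)
Lemma cauchy_derivative f w r : 0 < r ->
  (forall z, cmod z <= r -> derivable f (w + z) 1) ->
  circle_int (fun z => (f (w + z) - f w) / z) r = (2 * pi)%:C%C * derive1 f w.
Proof.
move=> r0 df; apply: circle_int_puncture => //.
  move=> z /andP[z0 zr]; apply: cderiv_quotient (derivable_cderiv (df _ zr)).
  by rewrite -cmod_gt0.
move=> e e0.
have /derivable_cderiv/(_ _ e0)[d d0 dP] : derivable f w 1.
  by rewrite -(addr0 w); apply: df; rewrite cmod0 ltW.
exists d => // z /andP[z0 /dP].
have zn0 : z != 0 by rewrite -cmod_gt0.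
move: (f (w + z) - f w) => A.
by move=> H; rewrite -(ler_pM2r z0) -cmodM mulrBl divfK.
Qed.

Lemma cauchy_estimate f w r M : 0 < r ->
  (forall z, cmod z <= r -> derivable f (w + z) 1) ->
  (forall z, cmod z = r -> cmod (f (w + z) - f w) <= M) ->
  cmod (derive1 f w) <= M / r.
Proof.
move=> r0 df fM; have p0 := pi2_gt0.
rewrite -(ler_pM2l p0) -{1}(ger0_norm (ltW p0)) -cmod_real -cmodM.
rewrite -(cauchy_derivative r0 df) [leRHS]mulrC.
apply: cmod_circle_int; first exact: ltW.
  move=> z zr; have /derivable_cderiv dfz : derivable f (w + z) 1 by apply: df; rewrite zr.
  have z0 : z != 0 by rewrite -cmod_gt0 zr.
  by have /derivable_cderiv/cderiv_continuous := cderiv_quotient z0 dfz.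
move=> z zr; rewrite cmodM cmodV zr ler_wpM2r ?fM//.
by rewrite invr_ge0 ltW.
Qed.

End CircleIntegrals.

(** * The derivative of a holomorphic function is holomorphic *)
Section HolomorphicDerivative.
Context {R : realType}.
Implicit Types (f g : cplx R -> cplx R) (z w h k l : cplx R) (r s M : R).

Let disc z : cmod z < 1 -> unit_disc z. Proof. by []. Qed.

Lemma continuous_polar (x : R * R) :
  {for x, continuous (fun y : R * R => circle_pt y.1 y.2 : cplx R)}.
Proof.
have -> : (fun y : R * R => circle_pt y.1 y.2 : cplx R) =
    (fun y => (y.1)%:C%C * circle_pt 1 y.2).
  by apply/funext => y; rewrite circle_ptE.
apply: cvgM.
  apply: (@continuous_comp _ _ _ fst (fun r : R => r%:C%C : cplx R)); first exact: cvg_fst.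
  by apply: continuous_realC; exact: cvg_id.
apply: (@continuous_comp _ _ _ snd (circle_pt 1 : R -> cplx R)); first exact: cvg_snd.
exact: continuous_circle.
Qed.

(** Compactness of the polar rectangle that parametrizes the disc. *)
Lemma holomorphic_bounded f s : holomorphic f -> 0 <= s < 1 ->
  exists M, forall z, cmod z <= s -> cmod (f z) <= M.
Proof.
move=> hf /andP[s0 s1].
pose F (x : R * R) := cmod (f (circle_pt x.1 x.2)).
pose A : set (R * R) := `[0, s] `*` `[0, 2 * pi].
have cA : compact A by apply: compact_setX; exact: segment_compact.
have A0 : A !=set0.
  by exists (0, 0); split => /=; rewrite in_itv /= lexx ?s0 ?ltW ?pi2_gt0.
have cF : {within A, continuous F}.
  apply: continuous_in_subspaceT => x; rewrite inE => -[/= + _].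
  rewrite in_itv /= => /andP[x0 xs]; apply: continuous_cmod.
  apply: (@continuous_comp _ _ _ (fun y : R * R => circle_pt y.1 y.2 : cplx R) f).
    exact: continuous_polar.
  apply: holomorphic_continuous => //.
  by apply: disc; rewrite cmod_circle// (le_lt_trans xs).
have [c _ cP] := compact_EVT_max A0 cA cF.
exists (F c) => z zs; have [t t2 zE] := circle_ptP z.
rewrite zE; apply: (cP (cmod z, t)).
by rewrite inE; split; rewrite /= in_itv /= ?cmod_ge0 ?zs.
Qed.

Lemma cmod_segment z h s (x : R) : cmod z <= s -> cmod (z + h) <= s -> 0 <= x <= 1 ->
  cmod (z + x%:C%C * h) <= s.
Proof.
move=> zs zhs /andP[x0 x1].
have -> : z + x%:C%C * h = (1 - x)%:C%C * z + x%:C%C * (z + h).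
  by rewrite rmorphB rmorph1 /=; ring.
apply: (le_trans (cmodD _ _)); rewrite !cmodM !cmod_real !ger0_norm ?subr_ge0//.
have := ler_wpM2l x0 zhs.
have : (1 - x) * cmod z <= (1 - x) * s by rewrite ler_wpM2l ?subr_ge0.
by move: (cmod z) (cmod _) => A B; clear; lra.
Qed.

Lemma derive1_bound f s s' M : holomorphic f -> 0 <= s -> s < s' -> s' < 1 ->
  (forall z, cmod z <= s' -> cmod (f z) <= M) ->
  forall z, cmod z <= s -> cmod (derive1 f z) <= 2 / (s' - s) * M.
Proof.
move=> hf s0 ss' s'1 fM z zs; rewrite mulrAC.
have zd u : cmod u <= s' - s -> cmod (z + u) <= s'.
  by move=> us; apply: (le_trans (cmodD _ _)); rewrite -[s'](subrKC s) lerD.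
apply: cauchy_estimate; first by rewrite subr_gt0.
- by move=> u /zd zu; apply: hf; apply: disc; exact: le_lt_trans s'1.
- move=> u us; apply: (le_trans (cmodB _ _)); rewrite mulrDl mul1r.
  by rewrite lerD// fM ?zd ?us// (le_trans zs)// ltW.
Qed.

(** The increment [derive1 f (z + h) - derive1 f z] is the derivative at [z] of
    [u |-> f (u + h) - f u], a function of size [O (cmod h)] because [derive1 f] is
    bounded on compact discs; [cauchy_estimate] concludes. *)
Lemma derive1_lipschitz f s : holomorphic f -> 0 <= s < 1 ->
  exists2 L, 0 <= L & forall z h, cmod z <= s -> cmod (z + h) <= s ->
    cmod (derive1 f (z + h) - derive1 f z) <= L * cmod h.
Proof.
move=> hf /andP[s0 s1].
(* room for two steps of length [r] between the discs of radius [s] and 1 *)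
pose r := (1 - s) / 3; pose s1' := s + r; pose s2 := s + r + r.
have r0 : 0 < r by rewrite divr_gt0// subr_gt0.
have s3 : s2 = 1 - r by rewrite /s2 /r; field.
have s11 : 0 <= s1' by rewrite addr_ge0 ?s0 ?(ltW r0).
have s12 : s1' < s2 by rewrite /s2 -/s1' ltrDl.
have s2lt1 : s2 < 1 by rewrite s3 gtrBl.
have s2p : 0 <= s2 < 1 by rewrite s2lt1 (le_trans s11)// ltW.
have [M fM] := holomorphic_bounded hf s2p.
have M0 : 0 <= M by apply: le_trans (fM 0 _); rewrite ?cmod_ge0// cmod0; case/andP: s2p.
have := derive1_bound hf s11 s12 s2lt1 fM.
set M1 := 2 / _ * M => dM1.
have M10 : 0 <= M1 by rewrite mulr_ge0 ?divr_ge0 ?subr_ge0 ?(ltW s12) ?ler0n ?M0.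
have close u : cmod u <= s2 -> unit_disc u.
  by move=> us; apply: disc; exact: le_lt_trans s2lt1.
exists (2 * M1 / r); first by apply: divr_ge0; [apply: mulr_ge0|exact: ltW].
move=> z h zs zhs.
pose F u := f (h + u) - f u.
have dF u : cmod u <= r -> cderiv F (z + u) (derive1 f (h + (z + u)) - derive1 f (z + u)).
  move=> ur; apply: cderivB.
    apply: cderiv_shift; apply: derivable_cderiv; apply: hf; apply: close.
    rewrite addrA (addrC h) (le_trans (cmodD _ _))// (le_trans (lerD zhs ur))// ltW//.
  apply: derivable_cderiv; apply: hf; apply: close.
  by rewrite (le_trans (cmodD _ _))// (le_trans (lerD zs ur))// ltW.
have FM u : cmod u <= r -> cmod (F (z + u)) <= M1 * cmod h.
  move=> ur; rewrite /F (addrC h).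
  have seg x : 0 <= x <= 1 -> cmod (z + u + x%:C%C * h) <= s1'.
    apply: cmod_segment.
      by rewrite (le_trans (cmodD _ _))// (le_trans (lerD zs ur)).
    by rewrite addrAC (le_trans (cmodD _ _))// (le_trans (lerD zhs ur)).
  apply: (@mean_value_inequality _ f (derive1 f)) => x /seg xs.
    by apply: derivable_cderiv; apply: hf; apply: close; rewrite (le_trans xs)// ltW.
  exact: dM1.
have zz : cmod (0 : cplx R) <= r by rewrite cmod0 ltW.
have /cderiv_derive1 E := dF 0 zz.
rewrite addr0 (addrC h) in E; rewrite -E.
have -> : 2 * M1 / r * cmod h = 2 * (M1 * cmod h) / r by rewrite mulrAC !mulrA.
apply: cauchy_estimate => //.
  by move=> u ur; apply: cderiv_derivable; exact: dF.
move=> u ur; apply: (le_trans (cmodB _ _)); rewrite mulr2n mulrDl mul1r.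
rewrite lerD ?FM ?ur//; by have := FM 0 zz; rewrite addr0.
Qed.

Lemma holomorphic_quadratic f s : holomorphic f -> 0 <= s < 1 ->
  exists2 L, 0 <= L & forall z h, cmod z <= s -> cmod (z + h) <= s ->
    cmod (f (z + h) - f z - derive1 f z * h) <= L * cmod h ^+ 2.
Proof.
move=> hf s01; have [L L0 LP] := derive1_lipschitz hf s01; exists L => // z h zs zhs.
have s1 : s < 1 by case/andP: s01.
have -> : f (z + h) - f z - derive1 f z * h =
  (f (z + h) - derive1 f z * (z + h)) - (f z - derive1 f z * z) by ring.
rewrite expr2 mulrA.
apply: (@mean_value_inequality _ (fun u => f u - derive1 f z * u)
   (fun u => derive1 f u - derive1 f z * 1)) => x x01.
  apply: cderivB; last exact: cderivZ (cderiv_id _).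
  by apply: derivable_cderiv; apply: hf; apply: disc; rewrite (le_lt_trans (cmod_segment zs zhs x01)).
rewrite mulr1; apply: (le_trans (LP _ _ zs (cmod_segment zs zhs x01))).
rewrite ler_wpM2l// cmodM cmod_real; case/andP: x01 => x0 x1.
by rewrite ger0_norm// ler_piMl ?cmod_ge0.
Qed.

(** Put [F u := f (u + h) - f u]. By [cauchy_derivative], the increment of
    [derive1 f] from [w] to [w + h] is a circle integral of difference quotients of
    [F]. As [F u = derive1 f u * h + O (cmod h ^+ 2)] uniformly, this integral is [h]
    times the circle integral of the difference quotients of [derive1 f], up to
    [O (cmod h ^+ 2)]. *)
Theorem holomorphic_derive1 f : holomorphic f -> holomorphic (derive1 f).
Proof.
move=> hf w w1; pose r := (1 - cmod w) / 3; pose s := cmod w + r + r.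
have r0 : 0 < r by rewrite divr_gt0// subr_gt0.
have sE : s = 1 - r by rewrite /s /r; field.
have s01 : 0 <= s < 1 by rewrite {2}sE gtrBl r0 !addr_ge0 ?cmod_ge0 ?(ltW r0).
have s1 : s < 1 by case/andP: s01.
have [L L0 LP] := holomorphic_quadratic hf s01.
have [L' L'0 LP'] := derive1_lipschitz hf s01.
pose q u := (derive1 f (w + u) - derive1 f w) / u.
pose G := circle_int q r / (2 * pi)%:C%C.
have p0 := @pi2_gt0 R.
apply: (@cderiv_derivable _ _ _ G) => e e0.
pose K := 2 * L / r.
have K0 : 0 <= K by apply: divr_ge0; [apply: mulr_ge0|exact: ltW].
(* [K + 1] rather than [K], which may vanish *)
exists (Num.min r (e / (K + 1))).
  by rewrite lt_min r0 divr_gt0// ltr_wpDl.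
move=> h; rewrite lt_min => /andP[hr hK].
pose F u := f (h + u) - f u.
pose D u := (F (w + u) - F w - (derive1 f (w + u) - derive1 f w) * h) / u.
have ws u : cmod u <= r -> cmod (w + u) <= s.
  by move=> ur; rewrite (le_trans (cmodD _ _))// /s -addrA lerD// ler_wpDr// ltW.
have ws' u : cmod u <= r -> cmod (w + u + h) <= s.
  by move=> ur; rewrite (le_trans (cmodD _ _))// lerD// ?(ltW hr)// (le_trans (cmodD _ _))// lerD.
have dF u : cmod u <= r -> cderiv F (w + u) (derive1 f (h + (w + u)) - derive1 f (w + u)).
  move=> ur; apply: cderivB.
    apply: cderiv_shift; apply: derivable_cderiv; apply: hf; apply: disc.
    by rewrite (addrC h) (le_lt_trans (ws' _ ur)).
  by apply: derivable_cderiv; apply: hf; apply: disc; rewrite (le_lt_trans (ws _ ur)).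
have r00 : cmod (0 : cplx R) <= r by rewrite cmod0 ltW.
have Fquot := @cauchy_derivative _ F w r r0 (fun u ur => cderiv_derivable (dF u ur)).
have cq z : cmod z = r -> {for z, continuous q}.
  move=> zr; have z0 : z != 0 by rewrite -cmod_gt0 zr.
  suff c1 : {for z, continuous (fun u : cplx R => derive1 f (w + u))}.
    exact: (cvgM (cvgB c1 (@cst_continuous _ _ (derive1 f w) z))
      (cderiv_continuous (cderivV (cderiv_id z) z0))).
  apply: continuous_cmodP => d d0.
  have wz1 : cmod (w + z) <= cmod w + r by rewrite -zr cmodD.
  exists (Num.min r (d / (L' + 1))).
    by rewrite lt_min r0 divr_gt0// ltr_wpDl.
  move=> y; rewrite lt_min => /andP[yr yd].
  have E : w + y = (w + z) + (y - z) by rewrite -addrA (addrC z) subrK.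
  rewrite E; apply: (le_trans (LP' _ _ _ _)).
  - by rewrite ws ?zr.
  - by rewrite (le_trans (cmodD _ _))// lerD// ltW.
  move: yd; rewrite ltr_pdivlMr ?ltr_wpDl// mulrC => /ltW; apply: le_trans.
  by rewrite ler_wpM2r ?cmod_ge0// lerDl.
have cFq z : cmod z = r -> {for z, continuous (fun u => (F (w + u) - F w) / u)}.
  move=> zr; have z0 : z != 0 by rewrite -cmod_gt0 zr.
  have zr' : cmod z <= r by rewrite zr.
  by have /derivable_cderiv/cderiv_continuous := cderiv_quotient z0 (dF _ zr').
have chq z : cmod z = r -> {for z, continuous (fun u => h * q u)}.
  by move=> zr; exact: (cvgM (@cst_continuous _ _ h z) (cq z zr)).
have Dq : D = fun u => (F (w + u) - F w) / u - h * q u.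
  apply/funext => u; rewrite /D /q [LHS]mulrBl.
  by rewrite (mulrC (derive1 f (w + u) - derive1 f w)) -mulrA.
have DE : circle_int D r = (2 * pi)%:C%C * (derive1 f (w + h) - derive1 f w - G * h).
  rewrite Dq (circle_intB (ltW r0) cFq chq) Fquot.
  rewrite /circle_int /arc_int cintZ; last exact: seg_cont_circle (ltW r0) cq.
  rewrite -/(arc_int q r 0 (2 * pi)) -/(circle_int q r).
  have /cderiv_derive1 := dF 0 r00; rewrite addr0 (addrC h) => ->.
  have p2 : (2 * pi)%:C%C != 0 :> cplx R by rewrite realC_neq0// gt_eqF.
  rewrite [RHS]mulrBr /G; congr (_ - _).
  by rewrite [RHS]mulrA [in RHS](mulrC (2 * pi)%:C%C) divfK// mulrC.
have : cmod (circle_int D r) <= 2 * (L * cmod h ^+ 2) / r * (2 * pi).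
  apply: cmod_circle_int; first exact: ltW.
    move=> z zr; rewrite Dq; exact: (cvgB (cFq z zr) (chq z zr)).
  move=> z zr; rewrite /D cmodM cmodV zr ler_wpM2r ?invr_ge0 ?(ltW r0)//.
  have -> : F (w + z) - F w - (derive1 f (w + z) - derive1 f w) * h =
     (f (w + z + h) - f (w + z) - derive1 f (w + z) * h) -
     (f (w + h) - f w - derive1 f w * h).
    rewrite /F (addrC h (w + z)) (addrC h w).
    move: (f (w + z + h)) (f (w + z)) (f (w + h)) (f w) => a b c d.
    by move: (derive1 f (w + z)) (derive1 f w) => m n; ring.
  apply: (le_trans (cmodB _ _)); rewrite mulr2n mulrDl mul1r.
  have zr' : cmod z <= r by rewrite zr.
  have := ws _ r00; have := ws' _ r00; rewrite addr0 => whs wws.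
  exact: lerD (LP _ _ (ws _ zr') (ws' _ zr')) (LP _ _ wws whs).
rewrite DE cmodM cmod_real (ger0_norm (ltW p0)) mulrC ler_pM2r// => /le_trans; apply.
have -> : 2 * (L * cmod h ^+ 2) / r = (K * cmod h) * cmod h by rewrite /K; ring.
rewrite ler_wpM2r ?cmod_ge0//.
move: hK; rewrite ltr_pdivlMr ?ltr_wpDl// mulrC => /ltW; apply: le_trans.
by rewrite ler_wpM2r ?cmod_ge0// lerDl.
Qed.

End HolomorphicDerivative.

(** * Cauchy's formula and pointwise bounds in Hardy spaces *)
Section CauchyFormula.
Context {R : realType}.
Notation mu := (@lebesgue_measure R).
Implicit Types (f g : cplx R -> cplx R) (z w h k l : cplx R) (r s M A p : R).

Lemma holo_cderiv f z : holomorphic f -> cmod z < 1 -> cderiv f z (derive1 f z).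
Proof. by move=> hf z1; apply: derivable_cderiv; apply: hf. Qed.

Definition diff_quotient f w z :=
  if z == w then derive1 f w else (f z - f w) / (z - w).

Lemma cderiv_quadratic k l w z :
  cderiv (fun u => k * u + l / 2 * (u - w) ^+ 2) z (k + l * (z - w)).
Proof.
have -> : (fun u => k * u + l / 2 * (u - w) ^+ 2) =
    (fun u => k * u + l / 2 * ((u - w) * (u - w))).
  by apply/funext => u; rewrite expr2.
have dw := cderivB (cderiv_id z) (cderiv_cst w z).
apply: cderiv_eq (cderivD (cderivZ k (cderiv_id z)) (cderivZ (l / 2) (cderivM dw dw))) _.
by field.
Qed.

(** The mean value inequality for [f] minus its candidate Taylor polynomial, whose
    derivative is [o (cmod (u - w))] since [derive1 f] is differentiable at [w]. *)
Lemma second_order f w : holomorphic f -> cmod w < 1 -> forall e : R, 0 < e ->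
  exists2 d : R, 0 < d & forall h, cmod h < d ->
    cmod (f (w + h) - f w - derive1 f w * h - derive1 (derive1 f) w / 2 * h ^+ 2)
      <= e * cmod h ^+ 2.
Proof.
move=> hf w1 e e0; have [d d0 dP] := holo_cderiv (holomorphic_derive1 hf) w1 e0.
set b := derive1 (derive1 f) w in dP *.
exists (Num.min d (1 - cmod w)); first by rewrite lt_min d0 subr_gt0.
move=> h; rewrite lt_min => /andP[hd hw].
pose phi u := f u - (derive1 f w * u + b / 2 * (u - w) ^+ 2).
pose dphi u := derive1 f u - (derive1 f w + b * (u - w)).
have -> : f (w + h) - f w - derive1 f w * h - b / 2 * h ^+ 2 = phi (w + h) - phi w.
  have alg (a0 a1 a2 a3 u v : cplx R) : a0 - a1 - a2 * u - a3 * u ^+ 2 =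
      (a0 - (a2 * (u + v) + a3 * u ^+ 2)) - (a1 - a2 * v) by ring.
  by rewrite /phi (addrC w h) addrK subrr expr0n /= mulr0 addr0; exact: alg.
rewrite expr2 mulrA.
have xh (x : R) : 0 <= x <= 1 -> cmod (x%:C%C * h) <= cmod h.
  by move=> /andP[x0 x1]; rewrite cmodM cmod_real ger0_norm// ler_piMl ?cmod_ge0.
apply: (@mean_value_inequality _ phi dphi) => x /xh xle.
  apply: cderivB.
    apply: holo_cderiv => //; apply: (le_lt_trans (cmodD _ _)).
    by rewrite -ltrBrDl (le_lt_trans xle).
  exact: cderiv_quadratic.
rewrite /dphi (addrC w (x%:C%C * h)) addrK (addrC (x%:C%C * h)) opprD addrA.
have /dP H : cmod (x%:C%C * h) < d by rewrite (le_lt_trans xle).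
by apply: (le_trans H); rewrite ler_wpM2l// ltW.
Qed.

(** At [w] this is the expansion of order two, available because [derive1 f] is
    itself differentiable. *)
Lemma diff_quotient_holomorphic f w : holomorphic f -> cmod w < 1 ->
  holomorphic (diff_quotient f w).
Proof.
move=> hf w1 z z1; have [->|zw] := eqVneq z w; last first.
  have zw0 : z - w != 0 by rewrite subr_eq0.
  apply: (@cderiv_derivable _ _ _ _).
  apply: (@near_cderiv _ (fun u => (f u - f w) / (u - w)) _ _ _ (cmod (z - w))).
  - by rewrite cmod_gt0.
  - move=> u uz; rewrite /diff_quotient; case: eqVneq => // uw.
    by move: uz; rewrite uw cmod_distC ltxx.
  apply: cderivM.
    exact: cderivB (holo_cderiv hf z1) (cderiv_cst _ _).
  exact: cderivV (cderivB (cderiv_id z) (cderiv_cst w z)) zw0.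
apply: (@cderiv_derivable _ _ _ (derive1 (derive1 f) w / 2)) => e e0.
have [d d0 dP] := second_order hf w1 e0; exists d => // h hd.
have [->|h0] := eqVneq h 0; first by rewrite addr0 mulr0 subrr subr0 cmod0 mulr0.
have hp : 0 < cmod h by rewrite cmod_gt0.
rewrite /diff_quotient eqxx -subr_eq0 (addrC w) addrK (negbTE h0).
rewrite -(ler_pM2r hp) -cmodM -[leRHS]mulrA -expr2.
apply: le_trans (dP _ hd); rewrite le_eqVlt; apply/orP; left; apply/eqP.
have alg (a b c m u : cplx R) : u != 0 ->
    ((a - b) / u - c - m / 2 * u) * u = a - b - c * u - m / 2 * u ^+ 2.
  by move=> u0; field.
by rewrite (addrC w h) alg.
Qed.

(** On the circle, the conjugate of [z / (z - w)] equals [r^2 / (r^2 - w^* * z)],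
    which is holomorphic on the closed disc with value 1 at 0. *)
Lemma cauchy_kernel_int w r : 0 < r -> cmod w < r ->
  circle_int (fun z => z / (z - w)) r = (2 * pi)%:C%C.
Proof.
move=> r0 wr.
pose r2 : cplx R := (r ^+ 2)%:C%C; pose wb : cplx R := (w^*)%C.
pose g z := r2 / (r2 - wb * z).
have r2n0 : r2 != 0 by rewrite realC_neq0// expf_neq0// gt_eqF.
have den z : cmod z <= r -> r2 - wb * z != 0.
  move=> zr; rewrite -cmod_gt0; apply: lt_le_trans (ler_cmodB _ _).
  rewrite cmodM cmod_conj cmod_real ger0_norm ?sqr_ge0// subr_gt0 expr2.
  apply: (@le_lt_trans _ _ (cmod w * r)); first by rewrite ler_wpM2l ?cmod_ge0.
  by rewrite ltr_pM2r.
have dg z : cmod z <= r -> derivable g z 1.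
  move=> zr; have dd := cderivB (cderiv_cst r2 z) (cderivZ wb (cderiv_id z)).
  exact: cderiv_derivable (cderivZ r2 (cderivV dd (den _ zr))).
have := mean_value r0 dg; rewrite {2}/g mulr0 subr0 divff// mulr1 => gE.
have -> : circle_int (fun z => z / (z - w)) r = (circle_int g r)^*%C.
  rewrite /circle_int /arc_int -cint_conj; last first.
    apply: seg_cont_circle (ltW r0) _ => z zr.
    by apply: cderiv_continuous (derivable_cderiv (dg z _)); rewrite zr.
  apply: eq_cint => t _; set z := circle_pt r t.
  have zr : cmod z = r by rewrite cmod_circle// ltW.
  have zzb : (z^*)%C * z = r2 by rewrite mulJ_cmod zr.
  have z0 : z != 0 by rewrite -cmod_gt0 zr.
  have zbE : z^*%C = r2 / z by rewrite -zzb mulfK.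
  have zw0 : z - w != 0.
    by rewrite -cmod_gt0 (lt_le_trans _ (ler_cmodB _ _))// zr subr_gt0.
  have conjg (a u v : cplx R) : (a^*)%C = a ->
      ((a / (a - (v^*)%C * u))^*)%C = a / (a - v * (u^*)%C).
    by move=> aJ; rewrite rmorphM fmorphV rmorphB rmorphM /= conjcK aJ.
  have alg (a u v : cplx R) : a != 0 -> u != 0 -> u - v != 0 ->
      u / (u - v) = a / (a - v * (a / u)).
    move=> a0 u0 uv0; rewrite (_ : a - v * (a / u) = a / u * (u - v)); last by field.
    by field; rewrite uv0 a0 u0.
  rewrite /g /wb conjg; last exact: conjc_real.
  by rewrite zbE; exact: alg.
by rewrite gE; exact: conjc_real.
Qed.

Lemma derivable_cauchy_kernel w z r : cmod w < r -> cmod z = r ->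
  derivable (fun z => z / (z - w)) z 1.
Proof.
move=> wr zr; have zw0 : z - w != 0.
  by rewrite -cmod_gt0 (lt_le_trans _ (ler_cmodB _ _))// zr subr_gt0.
exact: cderiv_derivable (cderivM (cderiv_id z)
  (cderivV (cderivB (cderiv_id z) (cderiv_cst w z)) zw0)).
Qed.

(** The mean value property for [z |-> z * diff_quotient f w z], which vanishes
    at 0. *)
Lemma cauchy_formula f w r : holomorphic f -> 0 < r < 1 -> cmod w < r ->
  circle_int (fun z => f z * (z / (z - w))) r = (2 * pi)%:C%C * f w.
Proof.
move=> hf /andP[r0 r1] wr; have w1 : cmod w < 1 := lt_trans wr r1.
have hq := diff_quotient_holomorphic hf w1.
have dk z : cmod z <= r -> derivable (fun z => z * diff_quotient f w z) z 1.
  move=> zr; have z1 : cmod z < 1 := le_lt_trans zr r1.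
  exact: cderiv_derivable (cderivM (cderiv_id z) (holo_cderiv hq z1)).
have := mean_value r0 dk.
rewrite mul0r mulr0 => k0.
have kerc z : cmod z = r -> {for z, continuous (fun z => z / (z - w))}.
  move=> zr; apply: cderiv_continuous.
  exact: derivable_cderiv (derivable_cauchy_kernel wr zr).
have c1 z : cmod z = r -> {for z, continuous (fun z => f z * (z / (z - w)))}.
  move=> zr; have z1 : cmod z < 1 by rewrite zr.
  exact: cvgM (cderiv_continuous (holo_cderiv hf z1)) (kerc z zr).
have c2 z : cmod z = r -> {for z, continuous (fun z => f w * (z / (z - w)))}.
  by move=> zr; exact: cvgM (@cst_continuous _ _ (f w) z) (kerc z zr).
have E : circle_int (fun z => z * diff_quotient f w z) r =
   circle_int (fun z => f z * (z / (z - w)) - f w * (z / (z - w))) r.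
  apply: eq_cint => t _; rewrite /diff_quotient; case: eqVneq => [zw|_].
    by move: wr; rewrite -zw cmod_circle ?ltxx// ltW.
  by rewrite -mulrBl mulrCA.
move: k0; rewrite E (circle_intB (ltW r0) c1 c2) => /eqP.
rewrite subr_eq0 => /eqP ->.
rewrite /circle_int /arc_int cintZ; last first.
  exact: (@seg_cont_circle _ (fun z => z / (z - w)) _ (ltW r0) kerc).
by rewrite -/(arc_int (fun z => z / (z - w)) _ _ _) -/(circle_int _ _) cauchy_kernel_int// mulrC.
Qed.

Lemma submean f w r : holomorphic f -> 0 < r < 1 -> cmod w < r ->
  cmod (f w) * (r - cmod w) * (2 * pi) <=
  \int[mu]_(t in `[0, 2 * pi]) cmod (f (circle_pt r t)).
Proof.
move=> hf r01 wr; have /andP[r0 r1] := r01; have p0 := @pi2_gt0 R.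
have rw0 : 0 < r - cmod w by rewrite subr_gt0.
have := cauchy_formula hf r01 wr.
move=> /(congr1 (@cmod R)); rewrite cmodM cmod_real ger0_norm ?(ltW p0)// => E.
rewrite mulrAC -ler_pdivlMr// (mulrC (cmod _)) -E mulrC -RintegralZl//; last first.
  apply: (@seg_cont_integrable _ _ _ (fun t => cmod (f (circle_pt r t)))).
  by move=> t _; apply: continuous_cmod_circle; rewrite // (ltW r0).
have cont : seg_cont 0 (2 * pi)
    (fun t => f (circle_pt r t) * (circle_pt r t / (circle_pt r t - w))).
  apply: (@seg_cont_circle _ (fun z => f z * (z / (z - w))) _ (ltW r0)) => z zr.
  have z1 : cmod z < 1 by rewrite zr.
  have kc := derivable_cderiv (derivable_cauchy_kernel wr zr).
  exact: cderiv_continuous (cderivM (holo_cderiv hf z1) kc).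
apply: (le_trans (cmod_cint cont)); apply: le_Rintegral => //.
- exact: seg_cont_integrable (seg_cont_cmod cont).
- apply: (@seg_cont_integrable _ _ _ (fun t => (r - cmod w)^-1 * cmod (f (circle_pt r t)))).
  move=> t _; apply: cvgM; first exact: cvg_cst.
  by apply: continuous_cmod_circle; rewrite // (ltW r0).
- move=> t _; rewrite !cmodM cmodV mulrC ler_wpM2r ?cmod_ge0//.
  rewrite cmod_circle ?(ltW r0)// ler_pdivrMr; last first.
    by rewrite (lt_le_trans rw0)// -{1}(cmod_circle t (ltW r0)) ler_cmodB.
  rewrite mulrC ler_pdivlMr//.
  apply: le_trans (ler_cmodB _ _); rewrite cmod_circle ?(ltW r0)//.
  by rewrite ler_piMl ?(ltW rw0)// ltW.
Qed.

(** For [p < 1] the power [cmod f `^ p] is traded for [cmod f] on the circle, at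
    the price of a constant that depends on the size of [f] there. *)
Lemma submean_p f w r p (C : R) A : holomorphic f -> 0 < r < 1 -> cmod w < r -> 0 <= C ->
  (forall z, cmod z = r -> cmod (f z) <= C * cmod (f z) `^ p) ->
  (circle_mean p r f <= A%:E)%E ->
  cmod (f w) * (r - cmod w) <= C * A.
Proof.
move=> hf r01 wr C0 fC fA; have /andP[r0 r1] := r01; have p0 := @pi2_gt0 R.
rewrite -(ler_pM2r p0); apply: (le_trans (submean hf r01 wr)).
have cf : seg_cont 0 (2 * pi) (fun t => cmod (f (circle_pt r t))).
  by move=> t _; apply: continuous_cmod_circle; rewrite // (ltW r0).
have r01' : 0 <= r < 1 by rewrite (ltW r0).
rewrite -lee_fin /Rintegral fineK; last first.
  by apply: integrable_fin_num => //; exact: (seg_cont_integrable cf).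
have mp := @measurable_cmod_circle R f p r `[0, 2 * pi] hf r01'.
apply: (@le_trans _ _ (\int[mu]_(t in `[0%R, (2 * pi)%R])
   (C%:E * (cmod (f (circle_pt r t)) `^ p)%:E))%E).
  apply: ge0_le_integral => //.
  - by move=> t _; rewrite lee_fin cmod_ge0.
  - exact: (measurable_int mu (seg_cont_integrable cf)).
  - exact: measurable_funeM.
  - by move=> t _; rewrite -EFinM lee_fin; apply: fC; rewrite cmod_circle// ltW.
rewrite ge0_integralZl//; last by move=> t _; rewrite lee_fin powR_ge0.
rewrite -mulrA EFinM lee_wpmul2l ?lee_fin//.
move: fA; rewrite /circle_mean lee_pdivrMl// => fA.
by rewrite (le_trans fA)// -EFinM mulrC.
Qed.

(** Let [T] be the supremum of [cmod (f z) `^ p * (rho - cmod z)] over the disc of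
    radius [rho]. At a point [z], [submean_p] on the circle halfway between [z] and
    the circle of radius [rho], where [T] itself controls the size of [f], gives
    [T <= 2 * (T `^ (1 - p) * A `^ p)]. The power of [T] on the right is smaller than
    one, so [T] is absorbed; [T] is finite since [rho < 1]. *)
Lemma hardy_pointwise f p A rho : holomorphic f -> 0 < p < 1 -> 0 < rho < 1 -> 0 <= A ->
  (forall r, 0 < r < 1 -> (circle_mean p r f <= A%:E)%E) ->
  forall z, cmod z < rho -> cmod (f z) `^ p * (rho - cmod z) <= 2 `^ p^-1 * A.
Proof.
move=> hf /andP[p0 p1] /andP[rho0 rho1] A0 fA.
have rho01 : 0 <= rho < 1 by rewrite ltW.
have [M fM] := holomorphic_bounded hf rho01.
have M0 : 0 <= M by apply: le_trans (fM 0 _); rewrite ?cmod_ge0// cmod0 ltW.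
pose Y z := cmod (f z) `^ p * (rho - cmod z).
pose E := [set Y z | z in [set z | cmod z < rho]].
have Eb : has_ubound E.
  exists (M `^ p * rho) => _ [z /= zr <-]; apply: ler_pM.
  - exact: powR_ge0.
  - by rewrite subr_ge0 ltW.
  - by apply: ge0_ler_powR; rewrite ?nnegrE ?cmod_ge0// ?(ltW p0)// fM// ltW.
  - by rewrite gerBl cmod_ge0.
pose T := sup E.
have YT z : cmod z < rho -> Y z <= T.
  by move=> zr; apply: ub_le_sup => //; exists z.
have h0 : cmod (0 : cplx R) < rho by rewrite cmod0.
have E0 : E !=set0 by exists (Y 0); exists 0.
have T0 : 0 <= T.
  apply: le_trans (YT 0 h0).
  by rewrite mulr_ge0 ?powR_ge0// cmod0 subr0 ltW.
have key z : cmod z < rho -> Y z <= 2 * (T `^ (1 - p) * A `^ p).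
  move=> zr; pose d := (rho - cmod z) / 2; pose r := cmod z + d.
  have d0 : 0 < d by rewrite divr_gt0// subr_gt0.
  have rE : rho - r = d by rewrite /r /d; field.
  have rz : r - cmod z = d by rewrite /r addrC addKr.
  have zltr : cmod z < r by rewrite -subr_gt0 rz.
  have rrho : r < rho by rewrite -subr_gt0 rE.
  have r01 : 0 < r < 1 by rewrite (le_lt_trans (cmod_ge0 z) zltr) (lt_trans rrho).
  pose q := p^-1 - 1.
  have q0 : 0 <= q by rewrite subr_ge0 invf_ge1// ltW.
  have pn0 : p != 0 by rewrite gt_eqF.
  have fC u : cmod u = r -> cmod (f u) <= (T / d) `^ q * cmod (f u) `^ p.
    move=> ur; have [/eqP fu0|fu0] := boolP (cmod (f u) == 0).
      by rewrite fu0 mulr_ge0 ?powR_ge0.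
    have uT : cmod (f u) `^ p <= T / d.
      rewrite ler_pdivlMr// -rE -ur; apply: YT; by rewrite ur.
    have fE : cmod (f u) = (cmod (f u) `^ p) `^ q * cmod (f u) `^ p.
      rewrite -powRrM -powRD ?(negbTE fu0) ?implybT// /q mulrBr mulfV// mulr1 subrK.
      by rewrite powRr1 ?cmod_ge0.
    rewrite {1}fE ler_wpM2r ?powR_ge0//; apply: ge0_ler_powR => //.
      by rewrite nnegrE powR_ge0.
    by rewrite nnegrE divr_ge0// ltW.
  have := submean_p hf r01 zltr (powR_ge0 _ _) fC (fA _ r01).
  rewrite rz -ler_pdivlMr// => H.
  have {}H : cmod (f z) `^ p <= ((T / d) `^ q * A / d) `^ p.
    by apply: ge0_ler_powR; rewrite ?nnegrE ?cmod_ge0 ?(ltW p0)// !mulr_ge0 ?powR_ge0 ?invr_ge0 ?(ltW d0).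
  have HE : ((T / d) `^ q * A / d) `^ p = T `^ (1 - p) * A `^ p / d.
    have di : 0 <= d^-1 by rewrite invr_ge0 ltW.
    rewrite -mulrA powRM ?powR_ge0 ?mulr_ge0// -powRrM.
    have -> : q * p = 1 - p by rewrite /q mulrBl mulVf// mul1r.
    rewrite !powRM//.
    have -> : T `^ (1 - p) * d^-1 `^ (1 - p) * (A `^ p * d^-1 `^ p) =
       T `^ (1 - p) * A `^ p * (d^-1 `^ (1 - p) * d^-1 `^ p) by ring.
    rewrite -powRD ?subrK; last by rewrite invr_eq0 gt_eqF ?implybT.
    by rewrite powRr1.
  rewrite /Y; have -> : rho - cmod z = 2 * d by rewrite /d mulrC divfK.
  rewrite HE ler_pdivlMr// in H.
  by rewrite mulrCA ler_wpM2l.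
have TT : T <= 2 * (T `^ (1 - p) * A `^ p).
  by apply: ge_sup => // _ [z zr <-]; exact: key.
move=> z zr; apply: (le_trans (YT z zr)).
move: T0; rewrite le_eqVlt => /predU1P[<-|T0]; first by rewrite mulr_ge0 ?powR_ge0.
have Tp : 0 < T `^ (1 - p) by rewrite powR_gt0.
have {}TT : T `^ p <= 2 * A `^ p.
  rewrite -(ler_pM2l Tp) -powRD ?subrK ?powRr1 ?(ltW T0)//; last first.
    by rewrite gt_eqF ?implybT.
  by rewrite (le_trans TT)// mulrCA.
have pn0 : p != 0 by rewrite gt_eqF.
have root x : 0 <= x -> (x `^ p) `^ p^-1 = x.
  by move=> x0; rewrite -powRrM mulfV// powRr1.
rewrite -(root T (ltW T0)) -(root A A0) -powRM ?powR_ge0//.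
apply: ge0_ler_powR => //; first by rewrite invr_ge0 ltW.
  by rewrite nnegrE powR_ge0.
by rewrite nnegrE mulr_ge0 ?powR_ge0.
Qed.

End CauchyFormula.

(** * Bounds on Taylor coefficients *)
Section TaylorFunctionals.
Context {R : realType}.
Implicit Types (f g : cplx R -> cplx R) (z w h : cplx R) (r s M A p : R).

Lemma holomorphic_derive1n f n : holomorphic f -> holomorphic (derive1n n f).
Proof.
by move=> hf; elim: n => [//|n IH]; rewrite derive1nS; exact: holomorphic_derive1.
Qed.

Lemma derive1n_add f m n : derive1n m (derive1n n f) = derive1n (m + n) f.
Proof. by elim: m => [//|m IH]; rewrite addSn !derive1nS IH. Qed.

Lemma derive1_eq_disc f g : (forall z, cmod z < 1 -> f z = g z) ->
  holomorphic g -> forall z, cmod z < 1 -> derive1 f z = derive1 g z.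
Proof.
move=> fg hg z z1; apply: cderiv_derive1.
apply: (@near_cderiv _ g _ _ _ (1 - cmod z)); first by rewrite subr_gt0.
  move=> w wz; rewrite fg// -(subrK z w) (le_lt_trans (cmodD _ _))//.
  by rewrite -ltrBrDr.
exact: holo_cderiv.
Qed.

Lemma derive1nD f g n : holomorphic f -> holomorphic g ->
  forall z, cmod z < 1 ->
  derive1n n (fun z => f z + g z) z = derive1n n f z + derive1n n g z.
Proof.
move=> hf hg; elim: n => [//|n IH] z z1; rewrite !derive1nS.
have hfn := holomorphic_derive1n (n := n) hf; have hgn := holomorphic_derive1n (n := n) hg.
rewrite (derive1_eq_disc IH (holomorphicD hfn hgn) z1).
by apply: cderiv_derive1; apply: cderivD; exact: holo_cderiv.
Qed.

Lemma derive1nZ f k n : holomorphic f -> forall z, cmod z < 1 ->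
  derive1n n (fun z => k * f z) z = k * derive1n n f z.
Proof.
move=> hf; elim: n => [//|n IH] z z1; rewrite !derive1nS.
have hfn := holomorphic_derive1n (n := n) hf.
have hkf : holomorphic (fun z => k * derive1n n f z).
  by move=> w w1; exact: cderiv_derivable (cderivZ k (holo_cderiv hfn w1)).
rewrite (derive1_eq_disc IH hkf z1).
by apply: cderiv_derive1; exact: cderivZ k (holo_cderiv hfn z1).
Qed.

Lemma derive1nB f g n : holomorphic f -> holomorphic g ->
  forall z, cmod z < 1 ->
  derive1n n (fun z => f z - g z) z = derive1n n f z - derive1n n g z.
Proof.
move=> hf hg z z1.
have -> : (fun z => f z - g z) = (fun z => f z + -1 * g z).
  by apply/funext => u; rewrite mulN1r.
have hNg : holomorphic (fun z => -1 * g z).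
  by move=> w w1; exact: cderiv_derivable (cderivZ (-1) (holo_cderiv hg w1)).
by rewrite (derive1nD n hf hNg z1) (derive1nZ (-1) n hg z1) mulN1r.
Qed.

(** Iterated Cauchy estimates on intermediate discs. *)
Lemma derive1n_bound n s s' : 0 <= s -> s < s' -> s' < 1 ->
  exists2 C : R, 0 < C & forall f M, holomorphic f -> 
    (forall z, cmod z <= s' -> cmod (f z) <= M) ->
    forall z, cmod z <= s -> cmod (derive1n n f z) <= C * M.
Proof.
elim: n s => [|n IH] s s0 ss' s'1.
  exists 1 => // f M hf fM z zs; rewrite mul1r; apply: fM.
  by rewrite (le_trans zs)// ltW.
have [st ts'] := midf_lt ss'; set t := (s + s') / 2 in st ts'.
have t0 : 0 <= t by rewrite (le_trans s0)// ltW.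
have [C C0 CP] := IH t t0 ts' s'1.
exists (2 / (t - s) * C); first by rewrite mulr_gt0// divr_gt0// subr_gt0.
move=> f M hf fM z zs; rewrite derive1nS -[leRHS]mulrA.
exact: (@derive1_bound _ _ _ _ (C * M) (holomorphic_derive1n (n := n) hf) s0 st
  (lt_trans ts' s'1) (CP f M hf fM) z zs).
Qed.

Lemma taylor_coef_bound n k : exists2 C : R, 0 < C & forall f M, holomorphic f ->
  (forall z, cmod z <= 4^-1 -> cmod (f z) <= M) ->
  cmod (taylor_coef (derive1n n f) k) <= C * M.
Proof.
have q1 : (4^-1 : R) < 1 by rewrite invf_lt1// ltr1n.
have q0 : 0 < (4^-1 : R) by rewrite invr_gt0.
have [C C0 CP] := derive1n_bound (k + n) (lexx 0) q0 q1.
exists (C / (k`!)%:R); first by rewrite divr_gt0// ltr0n fact_gt0.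
move=> f M hf fM; rewrite /taylor_coef derive1n_add cmodM cmodV cmod_nat mulrAC.
rewrite ler_wpM2r ?invr_ge0//; apply: CP => //.
by rewrite cmod0.
Qed.

Lemma taylor_coefD f g n k : holomorphic f -> holomorphic g ->
  taylor_coef (derive1n n (fun z => f z + g z)) k =
  taylor_coef (derive1n n f) k + taylor_coef (derive1n n g) k.
Proof.
move=> hf hg; rewrite /taylor_coef !derive1n_add (derive1nD _ hf hg) ?mulrDl//.
by rewrite cmod0 ltr01.
Qed.

Lemma taylor_coefZ f a n k : holomorphic f ->
  taylor_coef (derive1n n (fun z => a * f z)) k =
  a * taylor_coef (derive1n n f) k.
Proof.
move=> hf; rewrite /taylor_coef !derive1n_add (derive1nZ _ _ hf) ?mulrA//.
by rewrite cmod0 ltr01.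
Qed.

Lemma taylor_coefB f g n k : holomorphic f -> holomorphic g ->
  taylor_coef (derive1n n (fun z => f z - g z)) k =
  taylor_coef (derive1n n f) k - taylor_coef (derive1n n g) k.
Proof.
move=> hf hg; rewrite /taylor_coef !derive1n_add (derive1nB _ hf hg) ?mulrBl//.
by rewrite cmod0 ltr01.
Qed.

Lemma hardy_small_uniform p d : 0 < p < 1 -> 0 < d ->
  exists2 A, 0 < A & forall f, holomorphic f -> (hardy_sup p f <= A%:E)%E ->
    forall z, cmod z <= 4^-1 -> cmod (f z) <= d.
Proof.
move=> p01 d0; have /andP[p0 p1] := p01.
pose K : R := 2 `^ p^-1 * 4; have K0 : 0 < K by rewrite mulr_gt0// powR_gt0.
exists (d `^ p / K); first by rewrite divr_gt0// powR_gt0.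
move=> f hf fA z z4; rewrite leNgt; apply/negP => dz.
have h01 : 0 < (2^-1 : R) < 1 by rewrite invr_gt0 invf_lt1 ?ltr0n ?ltr1n.
have A0 : 0 <= d `^ p / K by rewrite divr_ge0 ?powR_ge0// ltW.
have mA r : 0 < r < 1 -> (circle_mean p r f <= (d `^ p / K)%:E)%E.
  by move=> r01; apply: le_trans fA; exact: hardy_sup_ub.
have z2 : cmod z < 2^-1.
  by rewrite (le_lt_trans z4)// ltf_pV2 ?posrE// ltr_nat.
have := hardy_pointwise hf p01 h01 A0 mA z2.
have : d `^ p < cmod (f z) `^ p.
  by apply: gt0_ltr_powR; rewrite ?nnegrE ?cmod_ge0// ltW.
have q : 4^-1 <= 2^-1 - cmod z by move: z4; lra.
have -> : 2 `^ p^-1 * (d `^ p / K) = d `^ p * 4^-1.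
  by rewrite /K; field; rewrite gt_eqF// powR_gt0.
move=> H1 H2.
have H3 : cmod (f z) `^ p * 4^-1 <= cmod (f z) `^ p * (2^-1 - cmod z).
  by rewrite ler_wpM2l// powR_ge0.
have := le_trans H3 H2; rewrite ler_pM2r ?invr_gt0// => H4.
by have := lt_le_trans H1 H4; rewrite ltxx.
Qed.

End TaylorFunctionals.

(** * Continuity of Taylor coefficients *)
Section Gdelta.
Context {R : realType} {e : exponents R}.
Implicit Types f g : hardy_cap e.

Lemma hardy_cap_holomorphic f : holomorphic f.
Proof. by have [] := hfun_hardy f (expo_itv e 0). Qed.

Lemma hardy_cap_dist_ge_term f g k : hardy_cap_term f g k <= hardy_cap_dist f g.
Proof.
apply: le_trans (nondecreasing_cvgn_le _ _ k.+1).
- by rewrite /series /= big_nat_recr//= lerDr sumr_ge0// => i _; exact: hardy_cap_term_ge0.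
- apply: nondecreasing_series => i _ _; exact: hardy_cap_term_ge0.
- exact: hardy_cap_term_cvg.
Qed.

(** One term of the series defining the distance already controls the
    corresponding [hardy_dist], as [x / (1 + x)] is increasing. *)
Lemma hardy_cap_dist_control k (A : R) : 0 < A ->
  exists2 d : R, 0 < d & forall f g, hardy_cap_dist f g < d ->
    hardy_dist (e k) f g <= A.
Proof.
move=> A0; have A1 : 0 < 1 + A by rewrite addr_gt0.
exists (2^-1 ^+ k.+1 * (A / (1 + A))).
  by rewrite mulr_gt0 ?exprn_gt0 ?invr_gt0 ?divr_gt0.
move=> f g fgd; rewrite leNgt; apply/negP => AB.
have := le_lt_trans (hardy_cap_dist_ge_term f g k) fgd.
rewrite /hardy_cap_term ltr_pM2l ?exprn_gt0 ?invr_gt0//.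
set B := hardy_dist _ _ _ in AB *.
have B1 : 0 < 1 + B by rewrite addr_gt0// (lt_trans A0).
rewrite ltr_pdivrMr// mulrAC ltr_pdivlMr// mulrDr mulrDr !mulr1 (mulrC B) ltrD2r.
by move=> /(lt_trans AB); rewrite ltxx.
Qed.

(** Closeness in the metric gives closeness in one [H^p], hence uniform closeness
    on a small disc by [hardy_pointwise], hence closeness of all the derivatives
    at 0. *)
Lemma taylor_coef_continuous f n k (d : R) : 0 < d ->
  exists2 t : R, 0 < t & forall g, hardy_cap_dist f g < t ->
    cmod (taylor_coef (derive1n n f) k - taylor_coef (derive1n n g) k) <= d.
Proof.
move=> d0; have [C C0 CP] := taylor_coef_bound (R := R) n k.
have [A A0 AP] := hardy_small_uniform (expo_itv e 0) (divr_gt0 d0 C0).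
have [t t0 tP] := hardy_cap_dist_control 0 A0.
exists t => // g /tP fg.
have hf := hardy_cap_holomorphic (f := f); have hg := hardy_cap_holomorphic (f := g).
rewrite -taylor_coefB// -[leRHS](divfK (lt0r_neq0 C0)) mulrC.
apply: CP; first exact: holomorphicB.
apply: AP; first exact: holomorphicB.
have p01 : 0 < e 0%N <= 1 by have /andP[-> /ltW] := expo_itv e 0.
rewrite -[leLHS]fineK; last first.
  exact: (hardy_sup_fin p01 (hfun_hardy f (expo_itv e 0)) (hfun_hardy g (expo_itv e 0))).
by rewrite lee_fin.
Qed.

Lemma open_taylor_gt n (M : R) :
  open [set f : hardy_cap e | exists k, M < cmod (taylor_coef (derive1n n f) k)].
Proof.
rewrite openE => f [k fk]; rewrite /interior.
have D0 : 0 < (cmod (taylor_coef (derive1n n f) k) - M) / 2.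
  by rewrite divr_gt0// subr_gt0.
have [t t0 tP] := taylor_coef_continuous f n k D0.
apply/nbhs_ballP; exists t => // g fg; exists k.
have {}fg : hardy_cap_dist f g < t by [].
have := le_trans (ler_cmodB _ _) (tP _ fg).
move: fk; set a := cmod _; set b := cmod _; clear; lra.
Qed.

(** Unboundedness says that for each natural number [i] some coefficient exceeds
    [i] in modulus. *)
Lemma Gdelta_unbounded_taylor n : Gdelta (unbounded_taylor e n).
Proof.
exists (fun i => [set f : hardy_cap e |
    exists k, i%:R < cmod (taylor_coef (derive1n n f) k)]).
  by move=> i; exact: open_taylor_gt.
apply/seteqP; split=> [f unb i _|f fi [M fM]].
  apply: contrapT => nk; apply: unb; exists i%:R => k; rewrite leNgt.
  by apply/negP => ik; apply: nk; exists k.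
have [k] := fi (Num.bound `|M|) I.
rewrite ltNge => /negP; apply; rewrite (le_trans (fM k))//.
by rewrite (le_trans (ler_norm _))// ltW// archi_boundP.
Qed.

End Gdelta.

(** * A function with harmonic numbers as Taylor coefficients *)
Section Witness.
Context {R : realType}.
Implicit Types (f g F G : cplx R -> cplx R) (z w h : cplx R) (r s t M A p : R).

Lemma cint_segment_derivative f (df : cplx R -> cplx R) z h :
  (forall s : R, 0 <= s <= 1 -> cderiv f (z + s%:C%C * h) (df (z + s%:C%C * h))) ->
  seg_cont 0 1 (fun s : R => df (z + s%:C%C * h) * h) ->
  cint 0 1 (fun s => df (z + s%:C%C * h) * h) = f (z + h) - f z.
Proof.
move=> fdf cdf.
have E : f (z + h) - f z =
    (fun s : R => f (z + s%:C%C * h)) 1 - (fun s : R => f (z + s%:C%C * h)) 0.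
  by rewrite /= mul1r mul0r addr0.
rewrite E; apply: (@cint_FTC _ 0 1 (fun s : R => f (z + s%:C%C * h)) _ ler01 _ _ cdf).
  move=> s /fdf H; have := is_derive_Re_line 1 H; rewrite mul1r.
  have -> : (fun t : R => Re (1 * f (z + t%:C%C * h))) =
    (fun t : R => Re (f (z + t%:C%C * h))) by apply/funext => t; rewrite mul1r.
  by [].
have iE u : Re (- 'i%C * u) = Im u by case: u => a b /=; ring.
move=> s /fdf H; have := is_derive_Re_line (- 'i%C) H; rewrite iE.
have -> : (fun t : R => Re (- 'i%C * f (z + t%:C%C * h))) =
    (fun t : R => Im (f (z + t%:C%C * h))) by apply/funext => t; rewrite iE.
by [].
Qed.

Lemma cmod_den_ge z s : 0 <= s <= 1 -> 1 - cmod z <= cmod (1 - s%:C%C * z).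
Proof.
move=> /andP[s0 s1]; apply: le_trans (ler_cmodB _ _); rewrite cmod1 lerD2l lerN2.
by rewrite cmodM cmod_real ger0_norm// ler_piMl ?cmod_ge0.
Qed.

Lemma den_neq0 z s : cmod z < 1 -> 0 <= s <= 1 -> 1 - s%:C%C * z != 0.
Proof.
by move=> z1 s01; rewrite -cmod_gt0 (lt_le_trans _ (cmod_den_ge z s01))// subr_gt0.
Qed.

(** The kernel whose integral over [s] in [0, 1], times [z], is [- log (1 - z)]. *)
Definition geo z s : cplx R := (1 - s%:C%C * z)^-1.

Lemma seg_cont_geo z : cmod z < 1 -> seg_cont 0 1 (geo z).
Proof.
move=> z1 s s01.
have cs : {for s, continuous (fun s : R => s%:C%C : cplx R)}.
  by apply: continuous_realC; exact: cvg_id.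
apply: cvgV; first exact: den_neq0.
apply: cvgB; first exact: cvg_cst.
by apply: cvgM; [exact: cs|exact: cvg_cst].
Qed.

(** The integral form of [- log (1 - z)]: it needs no branch of the argument. *)
Definition neglog1m z := cint 0 1 (fun s => z * geo z s).

(** The integrand is the derivative of [s |-> s / (1 - s * z)]. *)
Lemma cint_geo2 z : cmod z < 1 ->
  cint 0 1 (fun s => geo z s * geo z s) = (1 - z)^-1.
Proof.
move=> z1.
pose f u := u * (1 - u * z)^-1; pose df u := (1 - u * z)^-1 * (1 - u * z)^-1.
have arg (s : R) : 0 + s%:C%C * 1 = s%:C%C :> cplx R by rewrite add0r mulr1.
have d1 (s : R) : 0 <= s <= 1 -> cderiv f (0 + s%:C%C * 1) (df (0 + s%:C%C * 1)).
  move=> s01; rewrite arg; set u : cplx R := s%:C%C.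
  have n0 : 1 - u * z != 0 by exact: den_neq0.
  have dd := cderivB (cderiv_cst 1 u) (cderivM (cderiv_id u) (cderiv_cst z u)).
  apply: cderiv_eq (cderivM (cderiv_id u) (cderivV dd n0)) _.
  by rewrite /df; clearbody u; field.
have c1 : seg_cont 0 1 (fun s : R => df (0 + s%:C%C * 1) * 1).
  have -> : (fun s : R => df (0 + s%:C%C * 1) * 1) =
     (fun s : R => geo z s * geo z s).
    by apply/funext => s; rewrite arg mulr1.
  exact: seg_contM (seg_cont_geo z1) (seg_cont_geo z1).
have := cint_segment_derivative d1 c1.
rewrite /f !add0r mul0r subr0 !mul1r => <-.
by apply: eq_cint => s _; rewrite arg mulr1.
Qed.

(** Differentiation under the integral sign, with an explicit remainder. *)
Lemma cderiv_neglog1m z : cmod z < 1 -> cderiv neglog1m z (1 - z)^-1.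
Proof.
move=> z1 e e0; pose d := (1 - cmod z) / 2.
have d0 : 0 < d by rewrite divr_gt0// subr_gt0.
have d3 : 0 < d ^+ 3 by rewrite exprn_gt0.
exists (Num.min d (e * d ^+ 3)); first by rewrite lt_min d0 mulr_gt0.
move=> h; rewrite lt_min => /andP[hd he].
have zh : cmod (z + h) <= 1 - d.
  apply: (le_trans (cmodD _ _)); move: hd; rewrite /d; lra.
have zh1 : cmod (z + h) < 1 by rewrite (le_lt_trans zh)// gtrBl.
pose k := geo.
have ck w : cmod w < 1 -> seg_cont 0 1 (k w) := @seg_cont_geo w.
pose rem s := h ^+ 2 * (s%:C%C * (k z s * k z s * k (z + h) s)).
have crem : seg_cont 0 1 rem.
  apply: seg_contM; first exact: seg_cont_cst.
  apply: seg_contM; first by move=> s _; apply: continuous_realC; exact: cvg_id.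
  exact: seg_contM (seg_contM (ck z z1) (ck z z1)) (ck _ zh1).
have cst w : seg_cont (0 : R) 1 (fun=> w : cplx R) by exact: seg_cont_cst.
have E : neglog1m (z + h) - neglog1m z - (1 - z)^-1 * h = cint 0 1 rem.
  rewrite -(cint_geo2 z1) [_ * h]mulrC -cintZ; last exact: seg_contM (ck z z1) (ck z z1).
  have c1 := seg_contM (cst (z + h)) (ck _ zh1).
  have c2 := seg_contM (cst z) (ck _ z1).
  have c3 := seg_contM (cst h) (seg_contM (ck z z1) (ck z z1)).
  rewrite /neglog1m -(cintB c1 c2) -(cintB (seg_contB c1 c2) c3).
  apply: eq_cint => s s01; rewrite /rem /k /geo.
  have n1 := den_neq0 z1 s01; have n2 := den_neq0 zh1 s01.
  move: n1 n2; set u : cplx R := s%:C%C; clearbody u => n1 n2.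
  by field; rewrite n1 n2.
rewrite E; apply: (@le_trans _ _ (cmod h ^+ 2 / d ^+ 3 * (1 - 0))).
  apply: (cmod_cint_le ler01 crem) => s s01.
  rewrite /rem cmodM cmodX ler_wpM2l ?exprn_ge0 ?cmod_ge0//.
  have kd w : d <= 1 - cmod w -> cmod (k w s) <= d^-1.
    move=> dw; have dpos := le_trans dw (cmod_den_ge w s01).
    by rewrite /k /geo cmodV lef_pV2 ?posrE// (lt_le_trans d0).
  have kz : cmod (k z s) <= d^-1 by apply: kd; rewrite /d; lra.
  have kzh : cmod (k (z + h) s) <= d^-1 by apply: kd; move: zh; lra.
  have /andP[s0 s1] := s01.
  rewrite !cmodM cmod_real ger0_norm// exprSr invfM expr2 invfM.
  have step : cmod (k z s) * cmod (k z s) * cmod (k (z + h) s) <= d^-1 * d^-1 * d^-1.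
    by do 2?[apply: ler_pM; rewrite ?mulr_ge0 ?cmod_ge0//].
  apply: le_trans step; rewrite ler_piMl// !mulr_ge0 ?cmod_ge0//.
rewrite subr0 mulr1 expr2 mulrAC ler_wpM2r ?cmod_ge0//.
by rewrite ler_pdivrMr// ltW.
Qed.

Lemma onem_neq0 z : cmod z < 1 -> 1 - z != 0.
Proof.
by move=> z1; rewrite -cmod_gt0 (lt_le_trans _ (ler_cmodB _ _))// cmod1 subr_gt0.
Qed.

(** Dividing a power series by [1 - z] takes partial sums of its coefficients. *)
Lemma derive1n_onem_recurrence F G n : holomorphic F -> holomorphic G ->
  (forall z, cmod z < 1 -> (1 - z) * F z = G z) ->
  derive1n n.+1 F 0 = n.+1%:R * derive1n n F 0 + derive1n n.+1 G 0.
Proof.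
move=> hF hG FG.
have d1 z : cderiv (fun z => 1 - z) z (- 1).
  by apply: cderiv_eq (cderivB (cderiv_cst 1 z) (cderiv_id z)) _; rewrite sub0r.
suff H : forall z, cmod z < 1 -> (1 - z) * derive1n n.+1 F z =
    n.+1%:R * derive1n n F z + derive1n n.+1 G z.
  by have := H 0; rewrite cmod0 ltr01 subr0 mul1r => ->.
elim: n => [|n IH] z z1.
  have E w : cmod w < 1 -> (fun z => (1 - z) * F z) w = G w by exact: FG.
  have E1 := derive1_eq_disc E hG z1.
  rewrite (cderiv_derive1 (cderivM (d1 z) (holo_cderiv hF z1))) in E1.
  rewrite !derive1n1 derive1n0 -E1.
  move: (F z) (derive1 F z) => a b; ring.
have hFn := holomorphic_derive1n (n := n.+1) hF.
have hFn' := holomorphic_derive1n (n := n) hF.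
have hGn := holomorphic_derive1n (n := n.+1) hG.
have hr : holomorphic (fun w => n.+1%:R * derive1n n F w + derive1n n.+1 G w).
  move=> w w1; exact: cderiv_derivable (cderivD (cderivZ _ (holo_cderiv hFn' w1))
    (holo_cderiv hGn w1)).
have := derive1_eq_disc IH hr z1.
rewrite (cderiv_derive1 (cderivM (d1 z) (holo_cderiv hFn z1))).
rewrite (cderiv_derive1 (cderivD (cderivZ _ (holo_cderiv hFn' z1)) (holo_cderiv hGn z1))).
have alg (a b c : cplx R) : (1 - z) * b + a * -1 = n.+1%:R * a + c ->
    (1 - z) * b = n.+2%:R * a + c.
  move=> E; rewrite -[n.+2%:R]natr1; have -> : (1 - z) * b = ((1 - z) * b + a * -1) + a by ring.
  by rewrite E; ring.
exact: alg.
Qed.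

Lemma derive1n_cst k n : derive1n n.+1 (fun _ : cplx R => k : cplx R) = fun=> 0.
Proof.
elim: n => [|n IH].
  by rewrite derive1n1; apply/funext => z; exact: cderiv_derive1 (cderiv_cst _ _).
by rewrite derive1nS IH; apply/funext => z; exact: cderiv_derive1 (cderiv_cst _ _).
Qed.

Lemma holomorphic_neglog1m : holomorphic neglog1m.
Proof. by move=> z z1; exact: cderiv_derivable (cderiv_neglog1m z1). Qed.

Lemma derive1n_neglog1m n : derive1n n.+1 neglog1m 0 = (n`!)%:R.
Proof.
have hL := holomorphic_derive1 holomorphic_neglog1m.
have L1 z : cmod z < 1 -> (1 - z) * derive1 neglog1m z = (fun=> 1) z.
  move=> z1; rewrite (cderiv_derive1 (cderiv_neglog1m z1)) mulfV//.
  exact: onem_neq0.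
have h1 : holomorphic (fun=> 1 : cplx R).
  by move=> z _; exact: cderiv_derivable (cderiv_cst _ _).
rewrite derive1Sn; elim: n => [|n IH].
  rewrite derive1n0 (cderiv_derive1 (cderiv_neglog1m _)) ?subr0 ?invr1//.
  by rewrite cmod0 ltr01.
by rewrite (derive1n_onem_recurrence n hL h1 L1) IH derive1n_cst addr0 -natrM.
Qed.

Lemma neglog1m0 : neglog1m 0 = 0.
Proof.
rewrite /neglog1m (_ : (fun s : R => _) = fun=> 0).
  by rewrite cint_cst ?mulr0.
by apply/funext => s; rewrite mul0r.
Qed.

(** Extended by 0 outside the disc, like the elements of [hardy_cap]. *)
Definition witness z := if cmod z < 1 then neglog1m z * (1 - z)^-1 else 0.

Lemma witnessE z : cmod z < 1 -> witness z = neglog1m z * (1 - z)^-1.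
Proof. by rewrite /witness => ->. Qed.

Lemma witness_near f z k : (forall w, cmod w < 1 -> f w = witness w) ->
  cmod z < 1 -> cderiv f z k -> cderiv witness z k.
Proof.
move=> fw z1; apply: (@near_cderiv _ f witness z k (1 - cmod z)).
  by rewrite subr_gt0.
move=> w wz; apply: fw; rewrite -(subrK z w) (le_lt_trans (cmodD _ _))//.
by rewrite -ltrBrDr.
Qed.

Lemma holomorphic_witness : holomorphic witness.
Proof.
move=> z; rewrite -[unit_disc z]/(is_true (cmod z < 1)) => z1.
have d1 := cderivB (cderiv_cst 1 z) (cderiv_id z).
have d2 := cderivM (cderiv_neglog1m z1) (cderivV d1 (onem_neq0 z1)).
by apply: cderiv_derivable (witness_near _ z1 d2) => w w1; rewrite witnessE.
Qed.

(** The coefficients of [- log (1 - z)] are [1 / k], and dividing by [1 - z] sums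
    them into harmonic numbers. *)
Lemma derive1n_witness n : derive1n n witness 0 = (n`!)%:R * (series harmonic n)%:C%C.
Proof.
have W z : cmod z < 1 -> (1 - z) * witness z = neglog1m z.
  by move=> z1; rewrite witnessE// mulrCA mulfV ?mulr1// onem_neq0.
elim: n => [|n IH].
  rewrite derive1n0 witnessE ?cmod0 ?ltr01// neglog1m0 mul0r.
  by rewrite /series /= big_geq// mulr0.
rewrite (derive1n_onem_recurrence n holomorphic_witness holomorphic_neglog1m W).
have E : (series harmonic n.+1)%:C%C = (series harmonic n)%:C%C + n.+1%:R^-1 :> cplx R.
  by rewrite seriesSr rmorphD /= fmorphV rmorph_nat.
rewrite IH derive1n_neglog1m E.
rewrite factS natrM; set H := (series _ n)%:C%C; clearbody H.
have : n.+1%:R != 0 :> cplx R by rewrite pnatr_eq0.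
by move: (n.+1%:R : cplx R) => c c0; field.
Qed.

Lemma unbounded_witness n (M : R) :
  exists k, M < cmod (taylor_coef (derive1n n witness) k).
Proof.
have S0 k : 0 <= series (@harmonic R) k.
  by apply: sumr_ge0 => i _; exact: harmonic_ge0.
apply: contrapT => nk.
have nd : nondecreasing_seq (series (@harmonic R)).
  by apply: nondecreasing_series => k _ _; exact: harmonic_ge0.
apply: (@dvg_harmonic R); apply: nondecreasing_is_cvgn => //.
exists M => _ [k _ <-]; rewrite leNgt; apply/negP => Mk; apply: nk; exists k.
apply: (lt_le_trans Mk).
rewrite /taylor_coef derive1n_add derive1n_witness !cmodM cmodV !cmod_nat cmod_real.
rewrite ger0_norm// mulrAC.
have h1 := nd _ _ (leq_addr n k).
have h2 : 1 <= ((k + n)`!)%:R / (k`!)%:R :> R.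
  by rewrite ler_pdivlMr ?ltr0n ?fact_gt0// mul1r ler_nat leq_fact// leq_addr.
by rewrite (le_trans h1)// -[leLHS]mul1r ler_wpM2r.
Qed.

End Witness.

(** * The witness lies in every Hardy space of exponent less than 1 *)
Section WitnessHardy.
Context {R : realType}.
Notation mu := (@lebesgue_measure R).
Implicit Types (z w h : cplx R) (a b c r s t p x y : R).

Lemma is_derive_affine_powR (al ka a t : R) : 0 < al + ka * t ->
  is_derive t 1 (fun x : R => (al + ka * x) `^ a) (a * (al + ka * t) `^ (a - 1) * ka).
Proof.
move=> pos.
have d1 : is_derive t 1 (fun x : R => al + ka * x) ka.
  apply: real_is_derive => e e0; exists 1 => // x _.
  by rewrite (_ : _ - _ = 0) ?normr0 ?mulr_ge0 ?(ltW e0)//; ring.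
exact: (@is_derive1_comp _ (fun y => y `^ a) (fun x => al + ka * x) t _ _
  (is_derive1_powR a pos) d1).
Qed.

Lemma seg_cont_affine_powR (al ka a b c : R) :
  (forall t, b <= t <= c -> 0 < al + ka * t) ->
  seg_cont b c (fun t => (al + ka * t) `^ a).
Proof.
move=> pos t /pos pt; have [d _] := is_derive_affine_powR a pt.
by apply: differentiable_continuous; exact/derivable1_diffP.
Qed.

(** The antiderivative [ka / (1 - s) * (al + ka * t) `^ (1 - s)] stays bounded when
    [al + ka * t] comes close to 0, because [s < 1]. *)
Lemma Rint_affine_powR (al ka b B s : R) : ka = 1 \/ ka = -1 -> 0 < s < 1 -> 0 <= b ->
  (forall t, 0 <= t <= b -> 0 < al + ka * t <= B) ->
  \int[mu]_(t in `[0, b]) (al + ka * t) `^ (- s) <= B `^ (1 - s) / (1 - s).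
Proof.
move=> ka1 /andP[s0 s1] b0 pos.
have q0 : 0 < 1 - s by rewrite subr_gt0.
have kk : ka * ka = 1 by case: ka1 => ->; ring.
have pos' t : 0 <= t <= b -> 0 < al + ka * t by case/pos/andP.
pose U t := ka / (1 - s) * (al + ka * t) `^ (1 - s).
have dU t : 0 <= t <= b -> is_derive t 1 U ((al + ka * t) `^ (- s)).
  move=> /pos' pt; have d := is_derive_affine_powR (1 - s) pt.
  have q1 : 1 - s != 0 by rewrite gt_eqF.
  have := is_deriveZ (ka / (1 - s)) d; rewrite (_ : 1 - s - 1 = - s); last by ring.
  rewrite [_ *: _](_ : _ = (al + ka * t) `^ (- s))//.
  rewrite /GRing.scale /=; set X := _ `^ _.
  have -> : ka / (1 - s) * ((1 - s) * X * ka) = (ka * ka) * X by clearbody X; field.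
  by rewrite kk mul1r.
rewrite (Rint_FTC b0 dU (seg_cont_affine_powR pos')) /U.
have le x : 0 <= x <= b -> 0 <= (al + ka * x) `^ (1 - s) <= B `^ (1 - s).
  move=> /pos/andP[p1 p2]; rewrite powR_ge0/=.
  by apply: ge0_ler_powR => //; rewrite ?nnegrE ?(ltW q0) ?(ltW p1)// (le_trans (ltW p1)).
have /le/andP[l1 l2] : 0 <= b <= b by rewrite b0 lexx.
have /le/andP[l3 l4] : 0 <= (0 : R) <= b by rewrite b0 lexx.
rewrite -mulrBr mulrAC ler_wpM2r ?invr_ge0 ?(ltW q0)//.
move: l1 l2 l3 l4; move: (_ `^ _) (_ `^ _) (_ `^ _) => X Y Z; clear -ka1.
by case: ka1 => -> ? ? ? ?; lra.
Qed.

Lemma powRN_le (x y s : R) : 0 <= s -> 0 < x -> x <= y -> y `^ (- s) <= x `^ (- s).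
Proof.
move=> s0 x0 xy; have y0 := lt_le_trans x0 xy.
rewrite !powRN lef_pV2 ?posrE ?powR_gt0//.
by apply: ge0_ler_powR; rewrite ?nnegrE ?(ltW x0) ?(ltW y0).
Qed.

Lemma cmod_onem_le2 z : cmod z < 1 -> 0 < cmod (1 - z) <= 2.
Proof.
move=> z1; rewrite cmod_gt0 onem_neq0//= (le_trans (cmodB _ _))// cmod1.
by move: z1; lra.
Qed.

(** The logarithm grows slower than any power: in the integral defining
    [neglog1m z], [cmod (1 - s * z)] is at least a third of [1 - s + cmod (1 - z)], so
    that [cmod (1 - s * z)^-1] is at most a multiple of
    [cmod (1 - z) `^ (- a) * (1 - s + cmod (1 - z)) `^ (a - 1)], which is integrable. *)
Lemma neglog1m_growth a z : 0 < a < 1 -> cmod z < 1 ->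
  cmod (neglog1m z) <= 3 * 3 `^ a / a * cmod (1 - z) `^ (- a).
Proof.
move=> /andP[a0 a1] z1; set d := cmod (1 - z).
have /andP[d0 d2] := cmod_onem_le2 z1; rewrite -/d in d0 d2.
have pos s : 0 <= s <= 1 -> 0 < (1 + d) + -1 * s <= 3.
  by move=> /andP[s0 s1]; apply/andP; split; lra.
have cg := seg_contM (@seg_cont_cst R _ 0 1 z) (seg_cont_geo z1).
apply: (le_trans (cmod_cint cg)).
pose q : R := 1 - a.
have q01 : 0 < q < 1 by apply/andP; split; rewrite /q; lra.
have cp : seg_cont 0 1 (fun t => (1 + d + -1 * t) `^ (- q)).
  by apply: seg_cont_affine_powR => t /pos/andP[].
have ip : mu.-integrable `[0, 1] (EFin \o (fun t => (1 + d + -1 * t) `^ (- q))).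
  exact: seg_cont_integrable cp.
pose C := 3 * d `^ (- a).
have C0 : 0 <= C by rewrite mulr_ge0 ?powR_ge0.
apply: (@le_trans _ _ (\int[mu]_(t in `[0, 1]) (C * (1 + d + -1 * t) `^ (- q)))).
  apply: le_Rintegral => //.
  - exact: seg_cont_integrable (seg_cont_cmod cg).
  - exact: (integrableZl _ C ip).
  - move=> s; rewrite /= in_itv /= => s01; have /andP[s0 s1] := s01.
    have /andP[xp _] := pos s s01; set x := _ + _ in xp *.
    have dx : d <= x by rewrite /x; lra.
    have sub : cmod (s%:C%C * z - z) <= 1 - s.
      have -> : s%:C%C * z - z = (s - 1)%:C%C * z by rewrite rmorphB /= rmorph1; ring.
      rewrite cmodM cmod_real distrC ger0_norm ?subr_ge0// ler_piMr ?subr_ge0//.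
      exact: ltW.
    have low : 1 - s <= cmod (1 - s%:C%C * z).
      apply: le_trans (ler_cmodB _ _); rewrite cmod1 lerD2l lerN2 cmodM cmod_real.
      by rewrite ger0_norm// ler_piMr// ltW.
    have x3 : x <= 3 * cmod (1 - s%:C%C * z).
      have : d <= cmod (1 - s%:C%C * z) + cmod (s%:C%C * z - z).
        rewrite /d; have -> : 1 - z = (1 - s%:C%C * z) + (s%:C%C * z - z) by ring.
        exact: cmodD.
      move: low sub; rewrite /x; move: (cmod _) (cmod (_ - z)) => A B ? ? ?; lra.
    have D0 : 0 < cmod (1 - s%:C%C * z) by rewrite cmod_gt0 den_neq0.
    have xi : x^-1 = x `^ (- a) * x `^ (- q).
      rewrite -powRD; last by apply/implyP => _; rewrite gt_eqF.
      have -> : - a + - q = -1 by rewrite /q; ring.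
      by rewrite powR_inv1// ltW.
    rewrite cmodM /geo cmodV; apply: (@le_trans _ _ (3 / x)).
      rewrite -[leRHS]mul1r; apply: ler_pM; rewrite ?cmod_ge0 ?invr_ge0 ?(ltW z1) ?(ltW D0)//.
      by rewrite ler_pdivlMr// mulrC ler_pdivrMr.
    rewrite xi /C -!mulrA ler_wpM2l// ler_wpM2r ?powR_ge0//.
    by apply: powRN_le => //; exact: ltW.
rewrite RintegralZl// /C.
have H := Rint_affine_powR (or_intror erefl) q01 ler01 pos.
have qa : 1 - q = a by rewrite /q; ring.
rewrite qa in H.
have -> : 3 * 3 `^ a / a * d `^ (- a) = 3 * d `^ (- a) * (3 `^ a / a) by ring.
by rewrite ler_wpM2l.
Qed.

Lemma sin_lower t : 0 <= t <= 2^-1 -> t / 2 <= sin t.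
Proof.
move=> /andP[t0 t1].
have [|c] := @MVT_segment _ sin cos 0 t t0.
  by apply: continuous_in_subspaceT => x _; exact: continuous_sin.
rewrite in_itv /= => /andP[c0 ct]; rewrite sin0 !subr0 => ->.
rewrite mulrC ler_wpM2r//.
have : `|cos c - 1| <= c.
  have := le_trans (normr_Re _) (cmod_chord 0 c).
  by rewrite /circle_pt /= cos0 !mul1r subr0 (ger0_norm c0).
rewrite ler_norml => /andP[H _]; move: H ct t1; clear; lra.
Qed.

(** The constant is crude: the sine controls small [t], while for the other [t]
    the cosine stays away from 1. *)
Lemma chord_lower t : 0 <= t <= pi -> t / 128 <= cmod (circle_pt 1 t - 1 : cplx R).
Proof.
move=> /andP[t0 tpi].
have ReE : `|cos t - 1| <= cmod (circle_pt 1 t - 1 : cplx R).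
  by apply: le_trans (normr_Re _); rewrite /circle_pt /= mul1r.
have ImE : `|sin t| <= cmod (circle_pt 1 t - 1 : cplx R).
  by apply: le_trans (normr_Im _); rewrite /circle_pt /= mul1r subr0.
have [t1|t1] := leP t 2^-1.
  apply: le_trans ImE; have st : t / 2 <= sin t by apply: sin_lower; rewrite t0.
  rewrite (le_trans _ (ler_norm _))//; move: t0 st; clear; lra.
apply: le_trans ReE; rewrite distrC (le_trans _ (ler_norm _))//.
have p4 : pi <= 4 :> R by have := @pihalf_lt2 R; lra.
have p2 : 2 <= pi :> R := @pi_ge2 R.
have h2 : 0 <= (2^-1 : R) <= 2^-1 by rewrite lexx invr_ge0 ler0n.
have ct : cos t <= cos 2^-1.
  rewrite leNgt ltr_cos ?in_itv//= ?t0 ?tpi// -?leNgt ?(ltW t1)//.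
  by apply/andP; split; move: p2; clear; lra.
have s2 := sin_lower h2.
have cs := cos2Dsin2 (2^-1 : R).
have c1 := cos_le1 (2^-1 : R).
have ss : (2^-1 / 2) ^+ 2 <= sin 2^-1 ^+ 2 :> R.
  by rewrite ler_pXn2r ?nnegrE//; move: s2; lra.
move: ct cs c1 ss tpi p4; move: (cos t) (cos 2^-1) (sin 2^-1); clear => x y z.
nra.
Qed.

(** [cmod (1 - circle_pt r t)] dominates both [1 - r] and the distance of [t] to
    the multiples of [2 * pi], of which 0 and [2 * pi] are the ends of the interval. *)
Lemma onem_circle_lower r t : 0 <= r <= 1 -> 0 <= t <= 2 * pi ->
  1 - r + t <= 257 * cmod (1 - circle_pt r t : cplx R) \/
  1 - r + (2 * pi - t) <= 257 * cmod (1 - circle_pt r t : cplx R).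
Proof.
move=> /andP[r0 r1] /andP[t0 t2]; set d := cmod _.
have d1 : 1 - r <= d.
  by apply: le_trans (ler_cmodB _ _); rewrite cmod1 cmod_circle.
have d2 : cmod (circle_pt 1 t - 1 : cplx R) <= 2 * d.
  have -> : circle_pt 1 t - 1 = (circle_pt 1 t - circle_pt r t) - (1 - circle_pt r t) :> cplx R.
    by ring.
  apply: (le_trans (cmodB _ _)); rewrite -/d mulr2n mulrDl mul1r lerD2r.
  rewrite (circle_ptE r) -[X in X - _]mul1r -mulrBl cmodM cmod_circle1 mulr1.
  have -> : 1 - r%:C%C = (1 - r)%:C%C :> cplx R by rewrite rmorphB rmorph1.
  by rewrite cmod_real ger0_norm ?subr_ge0.
have [tpi|tpi] := leP t pi; [left|right].
  have := chord_lower (t := t); rewrite t0 tpi => /(_ isT) H.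
  move: H d1 d2; move: (cmod _) d; clear => ? ?; lra.
have := chord_lower (t := 2 * pi - t).
have -> : cmod (circle_pt 1 (2 * pi - t) - 1 : cplx R) = cmod (circle_pt 1 t - 1 : cplx R).
  rewrite -[in RHS]cmod_conj; congr cmod.
  rewrite /circle_pt mulr_natl cosB sinB cos2pi sin2pi.
  by apply/eqP; rewrite eq_complex /=; apply/andP; split; apply/eqP; ring.
have -> : 0 <= 2 * pi - t <= pi by apply/andP; split; move: t2 tpi; clear; lra.
move=> /(_ isT) H; move: H d1 d2; move: (cmod _) d (2 * pi - t); clear => ? ? ?; lra.
Qed.

Lemma continuous_onem_circle r : continuous (fun t : R => 1 - circle_pt r t : cplx R).
Proof.
move=> t.
exact: (cvgB (@cst_continuous _ _ (1 : cplx R) t) (@continuous_circle R r t)).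
Qed.

Lemma Rint_onem_circle s : 0 < s < 1 -> exists C : R, forall r, 0 < r < 1 ->
  \int[mu]_(t in `[0, 2 * pi]) cmod (1 - circle_pt r t : cplx R) `^ (- s) <= C.
Proof.
move=> s01; have /andP[s0 s1] := s01; have p0 := @pi2_gt0 R.
exists (257 `^ s * ((1 + 2 * pi) `^ (1 - s) / (1 - s) + (1 + 2 * pi) `^ (1 - s) / (1 - s))).
move=> r /andP[r0 r1].
pose u1 t := (1 - r + 1 * t) `^ (- s).
pose u2 t := (1 - r + 2 * pi + -1 * t) `^ (- s).
have pos1 t : 0 <= t <= 2 * pi -> 0 < 1 - r + 1 * t <= 1 + 2 * pi.
  by move=> /andP[? ?]; apply/andP; split; lra.
have pos2 t : 0 <= t <= 2 * pi -> 0 < 1 - r + 2 * pi + -1 * t <= 1 + 2 * pi.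
  by move=> /andP[? ?]; apply/andP; split; lra.
have i1 : mu.-integrable `[0, 2 * pi] (EFin \o u1).
  by apply: seg_cont_integrable; apply: seg_cont_affine_powR => t /pos1/andP[].
have i2 : mu.-integrable `[0, 2 * pi] (EFin \o u2).
  by apply: seg_cont_integrable; apply: seg_cont_affine_powR => t /pos2/andP[].
have i12 : mu.-integrable `[0, 2 * pi] (EFin \o (fun t => u1 t + u2 t)).
  exact: (integrableD _ i1 i2).
pose D t := cmod (1 - circle_pt r t : cplx R).
have D0 t : 0 < D t.
  by rewrite /D cmod_gt0 onem_neq0// cmod_circle// ltW.
have cD : seg_cont 0 (2 * pi) (fun t => D t `^ (- s)).
  move=> t _.
  have cDt : {for t, continuous D}.
    exact: continuous_cmod (@continuous_onem_circle r t).
  apply: (@continuous_comp _ _ _ D (fun x => x `^ (- s))) => //.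
  have [dp _] := is_derive1_powR (- s) (D0 t).
  by apply: differentiable_continuous; exact/derivable1_diffP.
apply: (@le_trans _ _ (\int[mu]_(t in `[0, 2 * pi]) (257 `^ s * (u1 t + u2 t)))).
  apply: le_Rintegral => //.
  - exact: (seg_cont_integrable cD).
  - exact: (integrableZl _ (257 `^ s) i12).
  - move=> t; rewrite /= in_itv /= => t2; rewrite -/(D t).
    have key x : 0 < x -> x <= 257 * D t -> D t `^ (- s) <= 257 `^ s * x `^ (- s).
      move=> x0 xD; rewrite !powRN ler_pdivlMr ?powR_gt0// mulrC ler_pdivrMr ?powR_gt0//.
      have D0' := ltW (D0 t); rewrite -powRM ?ler0n//.
      apply: ge0_ler_powR; rewrite ?nnegrE;
        [exact: ltW|exact: ltW|exact: mulr_ge0 (ler0n _ _) D0'|exact: xD].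
    have r01 : 0 <= r <= 1 by rewrite !ltW.
    have /andP[p1 _] := pos1 t t2; have /andP[p2 _] := pos2 t t2.
    have e1 : 1 - r + t = 1 - r + 1 * t by ring.
    have e2 : 1 - r + (2 * pi - t) = 1 - r + 2 * pi + -1 * t by ring.
    rewrite mulrDr; have [|] := onem_circle_lower r01 t2.
      rewrite e1 => /(key _ p1) H; rewrite (le_trans H)// lerDl.
      by rewrite mulr_ge0 ?powR_ge0.
    rewrite e2 => /(key _ p2) H; rewrite (le_trans H)// lerDr.
    by rewrite mulr_ge0 ?powR_ge0.
rewrite RintegralZl// RintegralD// ler_wpM2l ?powR_ge0//.
apply: lerD.
- exact: (Rint_affine_powR (or_introl erefl) s01 (ltW p0) pos1).
- exact: (Rint_affine_powR (or_intror erefl) s01 (ltW p0) pos2).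
Qed.

(** By [neglog1m_growth] the witness is [O (cmod (1 - z) `^ (- (1 + a)))] for every
    [a > 0]; choosing [a] with [(1 + a) * p < 1] makes its power [p] integrable over
    the circles, uniformly in the radius. *)
Lemma hardy_witness p : 0 < p < 1 -> hardy p (witness : cplx R -> cplx R).
Proof.
move=> /andP[p0 p1]; split; first exact: holomorphic_witness.
(* [(1 + a) * p < 1] since [a < 1 - p] and [p < 1] *)
pose a := (1 - p) / 2; pose s := (1 + a) * p.
have a01 : 0 < a < 1 by rewrite /a; apply/andP; split; lra.
have /andP[a0 a1] := a01.
have s01 : 0 < s < 1.
  by apply/andP; split; [rewrite mulr_gt0// addr_gt0|rewrite /s /a; nra].
have [C HC] := Rint_onem_circle s01.
pose K := (3 * 3 `^ a / a) `^ p.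
have K0 : 0 <= K by exact: powR_ge0.
apply: (@le_lt_trans _ _ ((2 * pi)^-1 * (K * C))%:E); last exact: ltry.
apply: ge_ereal_sup => _ [r /= + <-]; rewrite in_itv /= => r01.
have /andP[r0 r1] := r01; have p2 := @pi2_gt0 R.
rewrite /circle_mean EFinM lee_wpmul2l ?lee_fin ?invr_ge0 ?(ltW p2)//.
pose D t := cmod (1 - circle_pt r t : cplx R).
have D0 t : 0 < D t.
  by rewrite /D cmod_gt0 onem_neq0// cmod_circle// ltW.
have cDt : continuous D.
  by move=> t; exact: continuous_cmod (@continuous_onem_circle r t).
have cD : seg_cont 0 (2 * pi) (fun t => D t `^ (- s)).
  move=> t _.
  apply: (@continuous_comp _ _ _ D (fun x => x `^ (- s))); first exact: cDt.
  have [dp _] := is_derive1_powR (- s) (D0 t).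
  by apply: differentiable_continuous; exact/derivable1_diffP.
have iD := seg_cont_integrable cD.
have r01' : 0 <= r < 1 by rewrite (ltW r0).
have mw := @measurable_cmod_circle R witness p r `[0, 2 * pi] holomorphic_witness r01'.
apply: (@le_trans _ _ (\int[mu]_(t in `[0%R, (2 * pi)%R]) (K * D t `^ (- s))%:E)%E).
  apply: ge0_le_integral => //.
  - by move=> t _; rewrite lee_fin powR_ge0.
  - exact: (measurable_int mu (integrableZl _ K iD)).
  - move=> t _; rewrite lee_fin.
    have z1 : cmod (circle_pt r t : cplx R) < 1 by rewrite cmod_circle// ltW.
    rewrite (witnessE z1) cmodM cmodV -/(D t).
    have Di : 0 <= (D t)^-1 by rewrite invr_ge0 ltW.
    apply: (@le_trans _ _ ((3 * 3 `^ a / a * D t `^ (- (1 + a))) `^ p)).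
      apply: ge0_ler_powR; rewrite ?nnegrE ?(ltW p0) ?mulr_ge0 ?cmod_ge0 ?powR_ge0//.
        by rewrite invr_ge0 ltW.
      have -> : D t `^ (- (1 + a)) = D t `^ (- a) / D t.
        have -> : - (1 + a) = - a + -1 by ring.
        rewrite powRD; last by apply/implyP => _; rewrite gt_eqF.
        by rewrite powR_inv1// ltW.
      by rewrite [leRHS]mulrA; exact: (ler_wpM2r Di (neglog1m_growth a01 z1)).
    rewrite powRM ?powR_ge0 ?mulr_ge0 ?powR_ge0 ?invr_ge0 ?(ltW a0)// -/K.
    by rewrite -powRrM mulNr.
have -> : (\int[mu]_(t in `[0%R, (2 * pi)%R]) (K * D t `^ (- s))%:E)%E =
   (\int[mu]_(t in `[0, 2 * pi]) (K * D t `^ (- s)))%:E.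
  rewrite /Rintegral fineK//; apply: integrable_fin_num => //.
  exact: (integrableZl _ K iD).
by rewrite RintegralZl// lee_fin ler_wpM2l// HC.
Qed.

End WitnessHardy.

(** * Density *)
Section Density.
Context {R : realType} {e : exponents R}.
Implicit Types (f g : cplx R -> cplx R) (a p r : R).

Lemma hardy_supZ p a f : 0 <= a -> holomorphic f ->
  (hardy_sup p (fun z => a%:C%C * f z)%R <= (a `^ p)%:E * hardy_sup p f)%E.
Proof.
move=> a0 hf; apply: ge_ereal_sup => _ [r /= + <-]; rewrite in_itv /= => r01.
have r01' : 0 <= r < 1 by case/andP: r01 => r0 ->; rewrite ltW.
apply: (@le_trans _ _ ((a `^ p)%:E * circle_mean p r f)%E); last first.
  by rewrite lee_wpmul2l ?lee_fin ?powR_ge0//; exact: hardy_sup_ub.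
rewrite /circle_mean muleCA; apply: lee_wpmul2l.
  by rewrite lee_fin invr_ge0 mulr_ge0 ?pi_ge0.
rewrite -[leRHS]ge0_integralZl//.
- rewrite le_eqVlt; apply/orP; left; apply/eqP; apply: eq_integral => t _.
  by rewrite -EFinM cmodM cmod_real (ger0_norm a0) powRM ?cmod_ge0.
- exact: measurable_cmod_circle.
- by move=> t _; rewrite lee_fin powR_ge0.
- by rewrite lee_fin powR_ge0.
Qed.

Lemma holomorphicZ k f : holomorphic f -> holomorphic (fun z => k * f z).
Proof.
move=> hf z z1; exact: cderiv_derivable (cderivZ k (holo_cderiv hf z1)).
Qed.

Lemma hardyDZ p a f g : 0 < p < 1 -> 0 <= a -> hardy p f -> hardy p g ->
  hardy p (fun z => f z + a%:C%C * g z).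
Proof.
move=> /andP[p0 p1] a0 [hf fp] [hg gp].
have hag := @holomorphicZ a%:C%C g hg.
split; first exact: (holomorphicD hf hag).
have p01 : 0 < p <= 1 by rewrite p0 ltW.
apply: (le_lt_trans (hardy_supD p01 hf hag)).
have a0p : (0 <= (a `^ p)%:E)%E by rewrite lee_fin powR_ge0.
have agp := le_lt_trans (hardy_supZ p a0 hg) (lte_mul_pinfty a0p isT gp).
exact: (lte_add_pinfty fp agp).
Qed.

Lemma witness_out z : ~ unit_disc z -> witness z = 0 :> cplx R.
Proof. by rewrite /witness; case: ifPn. Qed.

Lemma perturb_hardy (f : hardy_cap e) a : 0 <= a -> forall p, 0 < p < 1 ->
  hardy p (fun z => f z + a%:C%C * witness z).
Proof.
by move=> a0 p p01; apply: hardyDZ => //; [exact: hfun_hardy|exact: hardy_witness].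
Qed.

Lemma perturb_out (f : hardy_cap e) a z : ~ unit_disc z ->
  f z + a%:C%C * witness z = 0.
Proof. by move=> zD; rewrite hfun_out// witness_out// mulr0 addr0. Qed.

Definition perturb (f : hardy_cap e) a (a0 : 0 <= a) : hardy_cap e :=
  HardyCap e (perturb_hardy f a0) (@perturb_out f a).

(** [hardy_dist] is homogeneous of degree [p]. *)
Lemma hardy_dist_perturb (f : hardy_cap e) a (a0 : 0 <= a) p : 0 < p < 1 ->
  hardy_dist p f (perturb f a0) <= a `^ p * fine (hardy_sup p (witness : cplx R -> cplx R)).
Proof.
move=> p01; have [hw wp] := hardy_witness p01.
have wfin : hardy_sup p (witness : cplx R -> cplx R) \is a fin_num.
  by rewrite ge0_fin_numE //; exact: hardy_sup_ge0.
have H := hardy_supZ p a0 hw.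
have a0p : (0 <= (a `^ p)%:E)%E by rewrite lee_fin powR_ge0.
have agfin : hardy_sup p (fun z => a%:C%C * witness z) \is a fin_num.
  rewrite ge0_fin_numE; last exact: hardy_sup_ge0.
  exact: (le_lt_trans H (lte_mul_pinfty a0p isT wp)).
have E : hardy_sup p (fun z => f z - perturb f a0 z) =
    hardy_sup p (fun z => a%:C%C * witness z).
  rewrite -(hardy_supN p (fun z => a%:C%C * witness z)); congr hardy_sup.
  by apply/funext => z; rewrite /perturb /= opprD addrA subrr add0r.
by rewrite /hardy_dist E -lee_fin (fineK agfin) EFinM (fineK wfin).
Qed.

(** The first [K] terms are small because the distances are, the others because of
    the geometric weights. *)
Lemma series_hardy_cap_term_le (f g : hardy_cap e) K (d : R) : 0 <= d ->
  (forall k, (k < K)%N -> hardy_dist (e k) f g <= d) ->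
  forall N, series (hardy_cap_term f g) N <=
    d * (1 - 2^-1 ^+ N) + (if (N <= K)%N then 0 else 2^-1 ^+ K - 2^-1 ^+ N).
Proof.
move=> d0 fgd; elim=> [|N IH].
  by rewrite /series /= big_geq// expr0 subrr mulr0 addr0.
rewrite seriesSr; apply: (le_trans (lerD IH (lexx _))).
have D0 := hardy_dist_ge0 (e N) f g.
have D1 : 0 < 1 + hardy_dist (e N) f g by rewrite ltr_wpDr.
have q0 : 0 <= 2^-1 ^+ N :> R by rewrite exprn_ge0.
rewrite /hardy_cap_term; set D := hardy_dist _ _ _ in D0 D1 *.
have [NK|KN] := ltnP N K.
  rewrite (ltnW NK) !addr0 exprS.
  have phi : D / (1 + D) <= d.
    rewrite ler_pdivrMr//; have := fgd _ NK; rewrite -/D => Dd.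
    by rewrite (le_trans Dd)// ler_peMr// lerDl.
  have := ler_wpM2l q0 phi; move: (D / _) (2^-1 ^+ N) => x y; clear; lra.
have phi : D / (1 + D) <= 1 by rewrite ler_pdivrMr// mul1r lerDr.
have := ler_wpM2l q0 phi.
have dq : 0 <= d * 2^-1 ^+ N by rewrite mulr_ge0.
rewrite exprS; case: ifPn => [NK|_].
  have NKe : N = K by apply/eqP; rewrite eqn_leq NK KN.
  rewrite NKe in dq *; move: dq.
  by move: (D / _) (2^-1 ^+ K) => x y; clear; lra.
move: (D / _) (2^-1 ^+ N) (2^-1 ^+ K) dq => x y w dq; move: dq; clear; lra.
Qed.

(** Only the first [K] exponents matter up to [2^-1 ^+ K]. The scale [a] is tuned to
    the smallest of them, [e 0]: for [a <= 1] this bounds all the other powers of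
    [a]. *)
Lemma perturb_close (f : hardy_cap e) (d : R) : 0 < d ->
  exists a, exists2 a0 : 0 <= a, 0 < a & hardy_cap_dist f (perturb f a0) < d.
Proof.
move=> d0; have d4 : 0 < d / 4 by rewrite divr_gt0.
have [K Kd] : exists K, 2^-1 ^+ K < d / 2.
  have [K Kd] := div_expn_small ler01 (divr_gt0 d0 (ltr0Sn R 1)).
  by exists K; rewrite exprVn -div1r.
pose w k := fine (hardy_sup (e k) (witness : cplx R -> cplx R)).
have w0 k : 0 <= w k by apply: fine_ge0; exact: hardy_sup_ge0.
pose W := \sum_(k < K) w k.
have W0 : 0 <= W by apply: sumr_ge0 => k _.
have W1 : 0 < W + 1 by rewrite ltr_wpDl.
(* chosen so that [a `^ e 0 = b] *)
pose b := Num.min 1 (d / 4 / (W + 1)).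
have b0 : 0 < b by rewrite lt_min ltr01 divr_gt0.
have b1 : b <= 1 by rewrite ge_min lexx.
have /andP[p0 p1] := expo_itv e 0.
pose a := b `^ (e 0%N)^-1.
have a0 : 0 < a by rewrite powR_gt0.
have a1 : a <= 1.
  have -> : 1 = 1 `^ (e 0%N)^-1 :> R by rewrite powR1.
  by apply: ge0_ler_powR; rewrite ?nnegrE ?invr_ge0 ?(ltW p0) ?(ltW b0).
have ab : a `^ (e 0%N) = b.
  by rewrite /a -powRrM mulVf ?gt_eqF// powRr1// ltW.
exists a, (ltW a0) => //.
set g := perturb f _.
have small k : (k < K)%N -> hardy_dist (e k) f g <= d / 4.
  move=> kK; apply: (le_trans (hardy_dist_perturb f (ltW a0) (expo_itv e k))).
  have ak : a `^ (e k) <= b.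
    rewrite -ab; apply: ger_powR; first by rewrite a0.
    by case: k kK => [//|k _]; rewrite ltW// expo_incr.
  have wW : w k <= W + 1.
    rewrite /W (bigD1 (Ordinal kK))//= -addrA lerDl addr_ge0//.
    by apply: sumr_ge0 => i _.
  apply: (@le_trans _ _ (b * (W + 1))).
    exact: ler_pM (powR_ge0 _ _) (w0 k) ak wW.
  by rewrite -ler_pdivlMr// ge_min lexx orbT.
have bound N : series (hardy_cap_term f g) N <= d / 4 + 2^-1 ^+ K.
  apply: (le_trans (series_hardy_cap_term_le (ltW d4) small N)).
  have qN : 0 <= 2^-1 ^+ N :> R by rewrite exprn_ge0.
  have qK : 0 <= 2^-1 ^+ K :> R by rewrite exprn_ge0.
  apply: lerD; first by rewrite ler_piMr ?(ltW d4)// gerBl.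
  by case: ifP => // _; rewrite gerBl.
apply: (@le_lt_trans _ _ (d / 4 + 2^-1 ^+ K)).
  by apply: limr_le; [exact: hardy_cap_term_cvg|exact: nearW].
by move: Kd d0; move: (2^-1 ^+ K) => x; clear; lra.
Qed.

(** If the coefficients of [f] are bounded, those of [f] plus a small multiple of
    the witness are not. *)
Lemma dense_unbounded_taylor n : dense (unbounded_taylor e n).
Proof.
move=> O [f Of] oO; have [fU|] := pselect (unbounded_taylor e n f); first by exists f.
rewrite /unbounded_taylor /= => /contrapT[M1 fM1].
have : nbhs f O by exact: open_nbhs_nbhs.
move=> /nbhs_ballP[d /= d0 dO].
have [a [a0 apos fa]] := perturb_close f d0.
exists (perturb f a0); split; first exact: dO.
move=> [M2 gM2].
have [k] := @unbounded_witness R n ((M1 + M2) / a).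
rewrite ltNge => /negP; apply; rewrite ler_pdivlMr//.
have hf := hardy_cap_holomorphic (f := f).
have hw := @holomorphic_witness R.
have haw := @holomorphicZ a%:C%C _ hw.
have E : a%:C%C * taylor_coef (derive1n n witness) k =
   taylor_coef (derive1n n (perturb f a0)) k - taylor_coef (derive1n n f) k.
  rewrite -(taylor_coefZ a%:C%C n k hw).
  have E1 : taylor_coef (derive1n n (perturb f a0)) k = _ := taylor_coefD n k hf haw.
  by rewrite E1 addrC addKr.
have -> : cmod (taylor_coef (derive1n n witness) k) * a =
    cmod (a%:C%C * taylor_coef (derive1n n witness) k) :> R.
  by rewrite [RHS]cmodM cmod_real (ger0_norm a0) mulrC.
by rewrite E (le_trans (cmodB _ _))// addrC lerD.
Qed.

End Density.

Theorem theorem3p2 (R : realType) (e : exponents R) (n : nat) :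
  Gdelta (unbounded_taylor e n) /\ dense (unbounded_taylor e n).
Proof.
by split; [exact: Gdelta_unbounded_taylor|exact: dense_unbounded_taylor].
Qed.
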